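(* There is a universal constant $C>0$ such that the following holds for every $n\ge2$. Fix positive edge activities $\lambda$ and rough hole weights $w$. Let $X_0\sim\pi^{\mathrm{HWS}}_{\lambda,w}$, and let $X_1,X_2,\dots$ evolve according to $P_{\mathrm{HWS}}(\lambda,w)$. For every $$S\in\{\mathcal P\}\cup\{\mathcal N(u,v):u\in V_1,\ v\in V_2\},$$ with $p_S:=\pi^{\mathrm{HWS}}_{\lambda,w}(S)$, and every integer $T\ge1$, $$\operatorname{Var}\Bigl[\frac1T\sum_{t=0}^{T-1}\mathbf 1_{\{X_t\in S\}}\Bigr]\le\frac{C\,n^2\log n}{T}\,p_S^2 .$$
   Context: Let $V_1,V_2$ be disjoint sets with $|V_1|=|V_2|=n$. In the complete bipartite graph on $(V_1,V_2)$ let $\mathcal P$ be the set of perfect matchings, let $\mathcal N(u,v)$ (for $(u,v)\in V_1\times V_2$) be the set of matchings with $n-1$ edges whose unmatched vertices (holes) are exactly $u$ and $v$, and let $\Omega=\mathcal P\cup\bigcup_{u,v}\mathcal N(u,v)$. Positive edge activities are a function $\lambda:V_1\times V_2\to(0,\infty)$; put $\lambda(M)=\prod_{e\in M}\lambda(e)$ and $\lambda(S)=\sum_{M\in S}\lambda(M)$ for $S\subseteq\Omega$. Ideal hole weights: $w^*(u,v)=\lambda(\mathcal P)/\lambda(\mathcal N(u,v))$. Positive hole weights $w:V_1\times V_2\to(0,\infty)$ are rough if $\frac12\le w(u,v)/w^*(u,v)\le 2$ for all $(u,v)$. Hole-weighted slide (HWS) chain. For distinct $v,a\in V_2$ and distinct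 $u,x\in V_1$ let $L_v(a)=\bigl(\sum_{z\in V_1}\lambda(z,a)/w(z,v)\bigr)^{-1}$, $R_u(x)=\bigl(\sum_{b\in V_2}\lambda(x,b)/w(u,b)\bigr)^{-1}$, and $L_v(v)=R_u(u)=0$. Let $D^L(u,v)=\sum_{a\in V_2\setminus\{v\}}\lambda(u,a)L_v(a)$, $D^R(u,v)=\sum_{x\in V_1\setminus\{u\}}\lambda(x,v)R_u(x)$, and $W(u,v)=w(u,v)+n\lambda(u,v)+D^L(u,v)+D^R(u,v)$. The transition matrix $P_{\mathrm{HWS}}=P_{\mathrm{HWS}}(\lambda,w)$ on $\Omega$ has non-loop transitions: - for $M\in\mathcal P$, $(u,v)\in M$: $P_{\mathrm{HWS}}(M,M\setminus\{(u,v)\})=\frac1{2n}$; - for $N\in\mathcal N(u,v)$: $P_{\mathrm{HWS}}(N,N\cup\{(u,v)\})=\frac{n\lambda(u,v)}{2W(u,v)}$; - for $N\in\mathcal N(u,v)$, $(x,a)\in N$: $P_{\mathrm{HWS}}(N,N\setminus\{(x,a)\}\cup\{(u,a)\})=\frac{\lambda(u,a)L_v(a)}{2W(u,v)}$ and $P_{\mathrm{HWS}}(N,N\setminus\{(x,a)\}\cup\{(x,v)\})=\frac{\lambda(x,v)R_u(x)}{2W(u,v)}$; all other non-loop probabilities are zero, with the remaining probability on the self-loop. The chain is lazy, irreducible, and reversible with respect to $\pi^{\mathrm{HWS}}_{\lambda,w}$, the probability distribution on $\Omega$ proportional to $n^2\lambda(M)$ for $M\in\mathcal P$ and $W(u,v)\lambda(M)$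 for $M\in\mathcal N(u,v)$. *)

(* Defs.v *)
From HB Require Import structures.
From mathcomp Require Import all_boot all_order all_algebra.
From mathcomp Require Import all_classical all_reals all_analysis.

Set Implicit Arguments.
Unset Strict Implicit.
Unset Printing Implicit Defensive.

Import Order.TTheory GRing.Theory Num.Theory.

Local Open Scope ring_scope.

(* The two sides of the bipartite graph are two separate types V1 and V2, so
   they are disjoint; the edge {u, v} is the pair (u, v). *)
Section Matchings.
Variables V1 V2 : finType.

Definition is_matching (M : {set V1 * V2}) : bool :=
  [forall e in M, forall f in M,
    ((e.1 == f.1) || (e.2 == f.2)) ==> (e == f)].

Definition covered1 (M : {set V1 * V2}) : {set V1} :=
  [set u | [exists v, (u, v) \in M]]%SET.
Definition covered2 (M : {set V1 * V2}) : {set V2} :=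
  [set v | [exists u, (u, v) \in M]]%SET.

Definition perfect_matchings : {set {set V1 * V2}} :=
  [set M : {set V1 * V2} |
    [&& is_matching M, covered1 M == [set: V1]%SET
      & covered2 M == [set: V2]%SET]]%SET.

Definition near_matchings (u : V1) (v : V2) : {set {set V1 * V2}} :=
  [set M : {set V1 * V2} |
    [&& is_matching M, #|M| == #|V1|.-1, ~: covered1 M == [set u]%SET
      & ~: covered2 M == [set v]%SET]]%SET.

Definition matching_space : {set {set V1 * V2}} :=
  (perfect_matchings :|: \bigcup_u \bigcup_v near_matchings u v)%SET.

Definition state : Type := {M : {set V1 * V2} | M \in matching_space}.
HB.instance Definition _ := SubFinite.on state.

End Matchings.

Section HoleWeightedSlide.
Variables (R : realType) (V1 V2 : finType).
Implicit Types (lam w : V1 * V2 -> R) (M : {set V1 * V2}) (u x : V1) (v a : V2).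

Definition activity lam M : R := \prod_(e in M) lam e.

Definition activity_set lam (S : {set {set V1 * V2}}) : R :=
  \sum_(M in S) activity lam M.

Definition ideal_hole_weight lam u v : R :=
  activity_set lam (perfect_matchings V1 V2)
    / activity_set lam (near_matchings u v).

Definition rough lam w : Prop :=
  (forall e, 0 < w e) /\
  forall u v, 2^-1 <= w (u, v) / ideal_hole_weight lam u v <= 2.

Definition slideL lam w v a : R :=
  if a == v then 0 else (\sum_(z : V1) lam (z, a) / w (z, v))^-1.

Definition slideR lam w u x : R :=
  if x == u then 0 else (\sum_(b : V2) lam (x, b) / w (u, b))^-1.

Definition sumL lam w u v : R :=
  \sum_(a | a != v) lam (u, a) * slideL lam w v a.

Definition sumR lam w u v : R :=
  \sum_(x | x != u) lam (x, v) * slideR lam w u x.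

Definition total_weight lam w u v : R :=
  w (u, v) + #|V1|%:R * lam (u, v) + sumL lam w u v + sumR lam w u v.

(* Transition probability for M' different from M.  The moves available at a
   given M have pairwise distinct targets, and a near-perfect matching has a
   single pair of holes, so at most one summand is nonzero. *)
Definition hws_move lam w M M' : R :=
  if M \in perfect_matchings V1 V2 then
    \sum_(e in M) (if M' == (M :\ e)%SET then (2 * #|V1|%:R)^-1 else 0)
  else
    \sum_(u : V1) \sum_(v : V2 | M \in near_matchings u v)
      ((if M' == ((u, v) |: M)%SET
        then #|V1|%:R * lam (u, v) / (2 * total_weight lam w u v) else 0)
       + \sum_(e in M)
           ((if M' == ((u, e.2) |: (M :\ e))%SET
             then lam (u, e.2) * slideL lam w v e.2
                    / (2 * total_weight lam w u v) else 0)
            + (if M' == ((e.1, v) |: (M :\ e))%SET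
               then lam (e.1, v) * slideR lam w u e.1
                      / (2 * total_weight lam w u v) else 0))).

Definition P_HWS lam w (M M' : state V1 V2) : R :=
  if M' == M
  then 1 - \sum_(M'' : state V1 V2 | M'' != M) hws_move lam w (val M) (val M'')
  else hws_move lam w (val M) (val M').

Definition hws_weight lam w (M : state V1 V2) : R :=
  if val M \in perfect_matchings V1 V2
  then #|V1|%:R ^+ 2 * activity lam (val M)
  else \sum_(u : V1) \sum_(v : V2 | val M \in near_matchings u v)
         total_weight lam w u v * activity lam (val M).

Definition pi_HWS lam w (M : state V1 V2) : R :=
  hws_weight lam w M / \sum_(M' : state V1 V2) hws_weight lam w M'.

Definition pi_HWS_set lam w (S : {set {set V1 * V2}}) : R :=
  \sum_(M : state V1 V2 | val M \in S) pi_HWS lam w M.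

End HoleWeightedSlide.

(* X is a Markov chain on the finite type S with initial distribution p and
   transition matrix P.  The Markov property is stated multiplied out, so that
   no conditioning on null events occurs. *)
Definition markov_chain (R : realType) (S : finType) (p : S -> R)
    (P : S -> S -> R) (d : measure_display) (Om : measurableType d)
    (Pr : probability Om R) (X : nat -> Om -> S) : Prop :=
  [/\ forall t s, measurable [set om | X t om = s]%classic,
      forall s, Pr [set om | X 0%N om = s]%classic = (p s)%:E
    & forall (t : nat) (x : nat -> S),
        Pr [set om | forall i, (i <= t.+1)%N -> X i om = x i]%classic =
        (Pr [set om | forall i, (i <= t)%N -> X i om = x i]%classic
           * (P (x t) (x t.+1))%:E)%E].

(* Main.v *)
Require Import Defs.
From HB Require Import structures.
From mathcomp Require Import all_boot all_order all_algebra all_fingroup.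
From mathcomp Require Import all_classical all_reals all_analysis.
From mathcomp Require Import ring lra zify.
Set Implicit Arguments.
Unset Strict Implicit.
Unset Printing Implicit Defensive.
Import Order.TTheory GRing.Theory Num.Theory.
Local Open Scope ring_scope.

(* Identify V2 with V1, so that a perfect matching is a permutation.

   For a stationary, reversible, lazy chain the variance of the average of f
   over T steps is at most 4 K / T as soon as Cov(f, g)^2 <= K D(g) for every g,
   where D(g) is the sum of pi(x) P(x, y) (g x - g y)^2.  For f = 1_S this
   follows from (E_N(u,v) g - E_P g)^2 <= C n^2 log n D(g), because pi restricted
   to a class is proportional to lambda.

   Draw N in N(u,v) and a perfect M independently.  Their superposition contains
   an alternating path from u to v, and switching N along it gives a perfect
   matching which is again distributed as M.  Sliding the left hole i times and
   the right hole j times along the path gives a triangular grid of near-perfect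
   matchings with apex N whose hypotenuse is wired to the switched matching.  As
   this grid is two-dimensional, the flow that is uniform on each antidiagonal
   has energy O(log n).  Finally, N + M minus the edges involved in a slide is a
   matching with four holes; switching paths once more bounds the total weight
   of those, and shows that no slide is used with more than O(n^2) times its
   conductance. *)

(** A single path of slides from N to the switched matching would cost its length, up to order n, in
    Cauchy-Schwarz. In the triangle the d+1 points of level d share the flow, so passing to level
    d+1 costs 1/(d+2) and all levels together a harmonic sum. This flow estimate contains no power
    of n: n^2 enters only because the normalising constant of the stationary law is at most 8 n^2
    times [perfect_total]. The obstacle is congestion. The hole total W(u,v) cancels between
    stationary weight and transition probability, so the conductance of a left slide is governed by
    L_v(a), which roughness places within a factor 2 of [perfect_total / left_channel v a]. The
    weight of the pairs using a slide must therefore be compared with [left_channel]. This succeeds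
    because [left_channel / perfect_total] is 1 on the diagonal and satisfies a multiplicative
    triangle inequality up to the factor 2. The second power of p_S has its origin in Cov(1_S, g) =
    p_S (E_S g - E g): the squared covariance carries p_S^2, and what remains is a difference of
    means, with no loss for a class of small mass. *)

Lemma ler_sum_sub (R : numDomainType) (I : finType) (P Q : pred I) (F : I -> R) :
  (forall i, P i -> Q i) -> (forall i, Q i -> 0 <= F i) ->
  \sum_(i | P i) F i <= \sum_(i | Q i) F i.
Proof.
move=> PQ F0; rewrite [leLHS]big_mkcond [leRHS]big_mkcond.
apply: ler_sum => i _; case: ifP => [/PQ -> //|_].
by case: ifP => [/F0|].
Qed.

(** * Switching two permutations along an alternating cycle *)

Section Flip.
Variable T : finType.
Implicit Types (s t : {perm T}) (u x y : T).

(** Permutation products act from left to right, so one step leaves along [t] and returns along [s]: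
    these are the left vertices of the component of [u] in the superposition of [s] and [t]. *)
Definition swap_cycle s t u : {set T} := porbit (t * s^-1)%g u.

Lemma swap_cycleC s t u : swap_cycle t s u = swap_cycle s t u.
Proof. by rewrite /swap_cycle -porbitV invMg invgK. Qed.

Lemma mem_swap_cycle s t u : u \in swap_cycle s t u.
Proof. exact: porbit_id. Qed.

Lemma swap_cycle_eq s t u x y : t x = s y -> (x \in swap_cycle s t u) = (y \in swap_cycle s t u).
Proof.
move=> e; have -> : y = (t * s^-1)%g x by rewrite permM e permK.
by rewrite /swap_cycle ![_ \in porbit _ u]porbit_sym (porbit_perm _ 1).
Qed.

Definition flip_fun s t u x := if x \in swap_cycle s t u then t x else s x.

Lemma flip_inj s t u : injective (flip_fun s t u).
Proof.
move=> x y; rewrite /flip_fun; case: ifP => xC; case: ifP => yC.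
- exact: perm_inj.
- by move=> e; rewrite (swap_cycle_eq u e) yC in xC.
- by move=> /esym e; rewrite (swap_cycle_eq u e) xC in yC.
- exact: perm_inj.
Qed.

Definition flip s t u : {perm T} := perm (@flip_inj s t u).

Lemma flipE s t u x : flip s t u x = if x \in swap_cycle s t u then t x else s x.
Proof. by rewrite permE. Qed.

(** On the cycle the flip exchanges [s] and [t], so the orbit of [u] is the same one run backwards.
    This makes flipping both matchings an involution, hence a change of variables in sums over
    pairs. *)
Lemma swap_cycle_flip s t u : swap_cycle (flip s t u) (flip t s u) u = swap_cycle s t u.
Proof.
set s' := flip s t u; set t' := flip t s u; rewrite -[RHS]swap_cycleC /swap_cycle.
have E k : ((t' * s'^-1)^+k)%g u = ((s * t^-1)^+k)%g u.
  elim: k => [|k IH]; first by rewrite !expg0.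
  rewrite !expgSr !permM IH; set x := ((s * t^-1) ^+ k)%g u.
  have xC : x \in swap_cycle t s u by apply: mem_porbit.
  rewrite flipE xC.
  have yC : t^-1%g (s x) \in swap_cycle s t u.
    by rewrite (@swap_cycle_eq _ _ _ _ x) ?permKV // -swap_cycleC.
  apply: (@perm_inj _ s'); rewrite permKV flipE yC permKV //.
by apply/setP => x; apply/porbitP/porbitP => -[k ->]; exists k; rewrite E.
Qed.

Lemma flipK s t u : flip (flip s t u) (flip t s u) u = s.
Proof.
apply/permP => x; rewrite flipE swap_cycle_flip !flipE swap_cycleC.
by case: (x \in swap_cycle t s u).
Qed.

Definition flip_pair u (p : {perm T} * {perm T}) := (flip p.1 p.2 u, flip p.2 p.1 u).

Lemma flip_pairK u : involutive (flip_pair u).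
Proof. by case=> s t; rewrite /flip_pair /= !flipK. Qed.

(** Multiplying by the transposition raises the number of orbits by one, and multiplying again
    restores it. The orbit count for the second product is consistent only if the two points have
    been separated. *)
Lemma porbit_tperm_notin (r : {perm T}) x y :
  x != y -> x \in porbit r y -> x \notin porbit (tperm x y * r)%g y.
Proof.
move=> xy xr; have := porbits_mul_tperm r x y.
have := porbits_mul_tperm (tperm x y * r)%g x y.
rewrite /= mulgA tperm2 mul1g xr xy /= addn0  => + e2; rewrite e2.
by rewrite -addnA => /addnI; case: (x \notin _).
Qed.

Lemma porbit_mul_tperm_notin (r : {perm T}) x y :
  x != y -> x \in porbit r y -> x \notin porbit (r * tperm x y)%g y.
Proof.
move=> xy xr; rewrite -porbitV invMg tpermV.
by apply: porbit_tperm_notin => //; rewrite porbitV.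
Qed.

Lemma mul_tpermC s u y : (tperm u y * s = s * tperm (s u) (s y))%g.
Proof.
by rewrite -tpermJ conjgE !mulgA mulgV mul1g.
Qed.

(** Exchanging two values of [s] is the same as exchanging their preimages [u] and [y], which lie on
    one cycle; a transposition of two points of a cycle cuts it between them. *)
Lemma swap_cycle_split s t u y v a : s u = v -> s y = a -> u != y ->
  y \in swap_cycle s t u -> y \notin swap_cycle (s * tperm v a)%g t u.
Proof.
move=> <- <- uy yC; rewrite -mul_tpermC /swap_cycle invMg tpermV mulgA tpermC.
by apply: porbit_mul_tperm_notin; rewrite 1?eq_sym.
Qed.

(** Since [t u = s y], the point [y] follows [u] on the cycle. After the relabelling [z] follows [u]
    instead, and the cut separates [z] from [y], so [u] stays with [z]. *)
Lemma swap_cycle_split_next s t u y z v a : s z = v -> t u = a -> s y = a ->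
  y != z -> z \in swap_cycle s t u -> y \notin swap_cycle (s * tperm a v)%g t u.
Proof.
move=> sz tu sy yz zC; set s' := (s * _)%g.
have yu : u \in swap_cycle s t y.
  by rewrite (@swap_cycle_eq s t y u y) ?mem_swap_cycle // tu.
have zy : z \in swap_cycle s t y.
  move: zC yu; rewrite /swap_cycle -!eq_porbit_mem => /eqP-> /eqP->; exact: eqxx.
have s'z : s' z = a by rewrite permM sz tpermR.
have -> : swap_cycle s' t u = swap_cycle s' t z.
  by apply/eqP; rewrite eq_porbit_mem (@swap_cycle_eq s' t z u z) ?mem_swap_cycle // tu.
rewrite /s' tpermC -sz -sy -mul_tpermC /swap_cycle invMg tpermV mulgA tpermC.
by apply: porbit_mul_tperm_notin => //; rewrite porbit_sym.
Qed.
End Flip.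

(** * Weights of matchings with one and two pairs of holes *)

Section Weights.
Variables (R : realFieldType) (T : finType) (A : T -> T -> R).
Hypothesis A_gt0 : forall x y, 0 < A x y.
Implicit Types (s t : {perm T}) (u x y : T).

Definition perm_weight s : R := \prod_x A x (s x).
(* A matching with holes u and v is encoded by the permutation s completing it
   with the edge s u = v, which carries no weight. *)
Definition near_weight s u : R := \prod_(x | x != u) A x (s x).
Definition near2_weight s u y : R := \prod_(x | (x != u) && (x != y)) A x (s x).
Definition perfect_total : R := \sum_s perm_weight s.
Definition near_total u v : R := \sum_(s : {perm T} | s u == v) near_weight s u.
Definition near2_total u y v a : R := \sum_(s : {perm T} | (s u == v) && (s y == a)) near2_weight s u y.
(* Up to the factor perfect_total, the reciprocal of the slide rate L_b(a) for
   the ideal hole weights. *)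
Definition left_channel b a : R := \sum_z A z a * near_total z b.

Lemma perm_weight_gt0 s : 0 < perm_weight s. Proof. exact: prodr_gt0. Qed.
Lemma near_weight_gt0 s u : 0 < near_weight s u. Proof. exact: prodr_gt0. Qed.
Lemma near2_weight_gt0 s u y : 0 < near2_weight s u y. Proof. exact: prodr_gt0. Qed.

Lemma perfect_total_gt0 : 0 < perfect_total.
Proof.
rewrite /perfect_total (bigD1 1%g) //= ltr_wpDr ?perm_weight_gt0 //.
by apply: sumr_ge0 => s _; exact/ltW/perm_weight_gt0.
Qed.

Lemma near_total_gt0 u v : 0 < near_total u v.
Proof.
rewrite /near_total (bigD1 (tperm u v)) /= ?tpermL // ltr_wpDr ?near_weight_gt0 //.
by apply: sumr_ge0 => s _; exact/ltW/near_weight_gt0.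
Qed.

Lemma left_channel_gt0 b a : 0 < left_channel b a.
Proof.
rewrite /left_channel (bigD1 a) //= ltr_wpDr ?mulr_gt0 ?near_total_gt0 //.
by apply: sumr_ge0 => s _; rewrite mulr_ge0 ?ltW ?near_total_gt0.
Qed.

Lemma perm_weightD1 s u : perm_weight s = A u (s u) * near_weight s u.
Proof. by rewrite /perm_weight (bigD1 u). Qed.

Lemma near_weightD1 s u y : u != y -> near_weight s u = A y (s y) * near2_weight s u y.
Proof. by move=> uy; rewrite /near_weight (bigD1 y) 1?eq_sym. Qed.

Lemma near2_weightC s u y : near2_weight s u y = near2_weight s y u.
Proof. by apply: eq_bigl => x; rewrite andbC. Qed.

Lemma eq_near2_weight s t u y : (forall x, x != u -> x != y -> s x = t x) ->
  near2_weight s u y = near2_weight t u y.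
Proof. by move=> e; apply: eq_bigr => x /andP[xu xy]; rewrite e. Qed.

(** [P] and [Q] mark the positions whose edges carry weight. The flip takes the edges on the cycle
    along with these marks, so a hole on the cycle passes to the other matching. *)
Lemma flip_weight (P Q : pred T) s t u :
  (\prod_(x | P x) A x (s x)) * (\prod_(x | Q x) A x (t x)) =
  (\prod_(x | if x \in swap_cycle s t u then Q x else P x) A x (flip s t u x)) *
  (\prod_(x | if x \in swap_cycle s t u then P x else Q x) A x (flip t s u x)).
Proof.
rewrite !(big_mkcond P) !(big_mkcond Q) -big_split /=.
rewrite [X in _ = X * _]big_mkcond [X in _ = _ * X]big_mkcond -big_split /=.
apply: eq_bigr => x _; rewrite !flipE (swap_cycleC s t).
by case: (x \in swap_cycle s t u); rewrite // mulrC.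
Qed.

Lemma sum_mul_pair (I J : finType) (P : pred I) (Q : pred J) (F : I -> R) (G : J -> R) :
  (\sum_(i | P i) F i) * (\sum_(j | Q j) G j) =
  \sum_(p : I * J | P p.1 && Q p.2) F p.1 * G p.2.
Proof. by rewrite big_distrlr /= pair_big. Qed.

Lemma sum_inj_le (I : finType) (h : I -> I) (P Q : pred I) (F G : I -> R) :
  injective h -> (forall i, P i -> Q (h i)) -> (forall i, P i -> F i <= G (h i)) ->
  (forall i, Q i -> 0 <= G i) -> \sum_(i | P i) F i <= \sum_(i | Q i) G i.
Proof.
move=> hI PQ FG G0; rewrite [leRHS](reindex_inj hI) /=.
apply: le_trans (ler_sum_sub PQ _) => [|i /G0 //]; exact: ler_sum.
Qed.

Definition relabel a v (p : {perm T} * {perm T}) := ((p.1 * tperm a v)%g, p.2).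

Lemma relabelK a v : involutive (relabel a v).
Proof. by case=> s t; rewrite /relabel /= -mulgA tperm2 mulg1. Qed.

(* Both sums split according to whether the cycle of [u] in the superposition
   contains [y]; if it does, relabelling the two holes of the first matching
   splits the cycle. *)
Lemma two_hole_bound u y v a : u != y ->
  perfect_total * near2_total u y v a <= near_total u v * near_total y a + near_total u a * near_total y v.
Proof.
move=> uy.
have part v' a' : \sum_(p : {perm T} * {perm T} |
       (p.1 u == v') && (p.1 y == a') && (y \notin swap_cycle p.1 p.2 u))
       near2_weight p.1 u y * perm_weight p.2 <= near_total u v' * near_total y a'.
  rewrite mulrC sum_mul_pair.
  apply: (sum_inj_le (inv_inj (@flip_pairK T u))) => [[s t]|[s t]|[s t] _] /=.
  - by rewrite !flipE (swap_cycleC s t) mem_swap_cycle => /andP[/andP[-> e] /negbTE yC]; rewrite yC e.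
  - move=> /andP[_ yC]; rewrite /near2_weight /perm_weight (flip_weight _ _ _ _ u).
    rewrite le_eqVlt; apply/orP; left; apply/eqP; congr (_ * _); apply: eq_bigl => x.
      case: ifP => xC; last by rewrite (_ : x != u) //; apply: contraFneq xC => ->; exact: mem_swap_cycle.
      by apply/esym; apply: contraNneq yC => <-.
    case: ifP => xC; last by apply/esym; apply: contraFneq xC => ->; exact: mem_swap_cycle.
    by rewrite (_ : x != y) ?andbT //; apply: contraNneq yC => <-.
  - by rewrite mulr_ge0 ?ltW ?near_weight_gt0.
rewrite mulrC sum_mul_pair (bigID (fun p => y \notin swap_cycle p.1 p.2 u)) /=.
apply: lerD.
  apply: le_trans (part v a); rewrite le_eqVlt; apply/orP; left.
  by apply/eqP/eq_bigl => p; rewrite andbT.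
apply: le_trans (part a v).
apply: (sum_inj_le (inv_inj (relabelK v a))) => [[s t]|[s t]|[s t] _] /=.
- rewrite andbT negbK !permM => /andP[/andP[/eqP su /eqP sy] yC].
  by rewrite su sy tpermL tpermR !eqxx (swap_cycle_split su sy uy yC).
- rewrite andbT => /andP[/andP[/eqP su /eqP sy] _].
  rewrite (@eq_near2_weight s (s * tperm v a)%g) // => x xu xy.
  by rewrite permM tpermD // -?su -?sy (inj_eq perm_inj) eq_sym.
- by rewrite mulr_ge0 ?ltW ?near2_weight_gt0 ?perm_weight_gt0.
Qed.

(** A perfect matching covers [a] by exactly one edge, so it is counted once, at the left end of
    that edge. *)
Lemma left_channel_diag a : left_channel a a = perfect_total.
Proof.
rewrite /left_channel /perfect_total /near_total; under eq_bigr do rewrite mulr_sumr.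
rewrite (exchange_big_dep predT) //=; apply: eq_bigr => s _.
rewrite (big_pred1 (s^-1 a)%g) => [|z]; first by rewrite (perm_weightD1 _ (s^-1 a)%g) permKV.
by rewrite /= -(inj_eq (@perm_inj _ s) z) permKV.
Qed.

(* When the cycle of u contains the hole z of s, exchanging the roles of z and of
   the other neighbour s^-1 a of a takes z off the cycle; this costs the factor 2. *)
Lemma hole_triangle u v a : v != a -> near_total u a * left_channel v a <= 2 * near_total u v * perfect_total.
Proof.
move=> va.
(* The first matching has right hole [v] and left hole [z = p.1^-1 v], and comes with an extra edge
   from [z] to [a]; the second has holes [u] and [a]. *)
pose F (p : {perm T} * {perm T}) :=
  A (p.1^-1 v)%g a * near_weight p.1 (p.1^-1 v)%g * near_weight p.2 u.
have F0 p : 0 <= F p by rewrite !mulr_ge0 ?ltW ?near_weight_gt0.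
have -> : near_total u a * left_channel v a = \sum_(p : {perm T} * {perm T} | p.2 u == a) F p.
  rewrite mulrC (_ : left_channel v a = \sum_(s : {perm T}) A (s^-1 v)%g a * near_weight s (s^-1 v)%g).
    by rewrite sum_mul_pair.
  rewrite /left_channel /near_total; under eq_bigr do rewrite mulr_sumr.
  rewrite (exchange_big_dep predT) //=; apply: eq_bigr => s _.
  rewrite (big_pred1 (s^-1 v)%g) // => z.
  by rewrite /= -(inj_eq (@perm_inj _ s) z) permKV.
pose far (p : {perm T} * {perm T}) := (p.1^-1 v)%g \notin swap_cycle p.1 p.2 u.
have far_le : \sum_(p : {perm T} * {perm T} | (p.2 u == a) && far p) F p <= near_total u v * perfect_total.
  rewrite sum_mul_pair.
  (* After the flip the first matching has weightless edges from [u] to [a] and from [z] to [v].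
     Relabelling turns them into a hole edge from [u] to [v] and an edge from [z] to [a], which uses
     up the extra factor. *)
  apply: (@sum_inj_le _ (fun p => relabel a v (flip_pair u p))) => [||[s t]|[s t] _] /=.
  - exact: inj_comp (inv_inj (relabelK a v)) (inv_inj (@flip_pairK T u)).
  - move=> [s t] /andP[/= /eqP tu _].
    by rewrite permM flipE mem_swap_cycle tu tpermL eqxx.
  - rewrite /far /= => /andP[/eqP tu zC].
    set z := (s^-1 v)%g in zC *.
    have sz : s z = v by rewrite permKV.
    have uz : u != z by apply: contraNneq zC => <-; exact: mem_swap_cycle.
    rewrite /F /= -/z -mulrA (_ : near_weight s z * near_weight t u = near2_weight (flip s t u) u z * perm_weight (flip t s u)); last first.
      rewrite /near_weight (flip_weight _ _ _ _ u); congr (_ * _); apply: eq_bigl => x.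
        case: ifP => xC; first by rewrite (_ : x != z) ?andbT //; apply: contraNneq zC => <-.
        by rewrite (_ : x != u) //; apply: contraFneq xC => ->; exact: mem_swap_cycle.
      case: ifP => xC; first by apply: contraNneq zC => <-.
      by apply: contraFneq xC => ->; exact: mem_swap_cycle.
    rewrite mulrA (near_weightD1 _ uz) permM flipE (negbTE zC) sz tpermR.
    rewrite (@eq_near2_weight (flip s t u) (flip s t u * tperm a v)%g) // => x xu xz.
    rewrite permM tpermD //.
      by rewrite (_ : a = flip s t u u) ?(inj_eq perm_inj) 1?eq_sym // flipE mem_swap_cycle.
    by rewrite (_ : v = flip s t u z) ?(inj_eq perm_inj) 1?eq_sym // flipE (negbTE zC).
  - by rewrite mulr_ge0 ?ltW ?near_weight_gt0 ?perm_weight_gt0.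
rewrite (bigID far) /= -mulrA mulrDl mul1r lerD //.
apply: le_trans far_le; apply: (sum_inj_le (inv_inj (relabelK a v))) => //.
- move=> [s t] /=; rewrite /far /= negbK => /andP[/eqP tu zC]; rewrite tu eqxx /=.
  rewrite invMg tpermV permM tpermR.
  apply: (@swap_cycle_split_next _ s t u (s^-1 a)%g (s^-1 v)%g) => //; rewrite ?permKV //.
  by rewrite (inj_eq perm_inj) eq_sym.
- move=> [s t] /= _; rewrite /F /= invMg tpermV permM tpermR.
  set z := (s^-1 v)%g; set y := (s^-1 a)%g.
  have yz : y != z by rewrite (inj_eq perm_inj) eq_sym.
  have sz : s z = v by rewrite permKV.
  have sy : s y = a by rewrite permKV.
  rewrite (@near_weightD1 s z y) 1?eq_sym // (@near_weightD1 _ y z) // permM sz sy tpermR near2_weightC.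
  rewrite (@eq_near2_weight s (s * tperm a v)%g); first by rewrite mulrCA.
  by move=> x xy xz; rewrite permM tpermD // -?sz -?sy (inj_eq perm_inj) eq_sym.
Qed.

Lemma near_total_left_channel u v a : near_total u a * left_channel v a <= 2 * near_total u v * perfect_total.
Proof.
case: (eqVneq v a) => [->|/hole_triangle//]; rewrite left_channel_diag.
by rewrite ler_pM2r ?perfect_total_gt0 // ler_peMl ?ler1n // ltW ?near_total_gt0.
Qed.

(** Each summand of [left_channel b a] contains [near_total z b], which together with
    [left_channel v b] is bounded by [near_total_left_channel]. *)
Lemma left_channel_mul v b a : left_channel v b * left_channel b a <= 2 * perfect_total * left_channel v a.
Proof.
rewrite {2}/left_channel mulr_sumr {2}/left_channel mulr_sumr; apply: ler_sum => z _.
rewrite mulrCA [leRHS]mulrCA ler_pM2l // mulrC.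
by apply: le_trans (near_total_left_channel z v b) _; rewrite mulrAC.
Qed.

(* The sum runs over the matchings missing u, y on the left and v, a on the right,
   together with an edge from y to b: the data that recover the pair of matchings
   from a slide between the right neighbours a and b. *)
Lemma channel_bound u v a b :
  left_channel b a * (\sum_(y | y != u) A y b * near2_total u y v a) <= 6 * perfect_total * near_total u v.
Proof.
rewrite -(ler_pM2l perfect_total_gt0) mulrCA mulr_sumr.
have H : \sum_(y | y != u) perfect_total * (A y b * near2_total u y v a) <=
    near_total u v * left_channel a b + near_total u a * left_channel v b.
  rewrite /left_channel !mulr_sumr -big_split /=.
  apply: (@sum_inj_le _ id (fun y => y != u) predT) => // y yu; last first.
    by rewrite addr_ge0 ?mulr_ge0 ?ltW ?near_total_gt0.
  rewrite mulrCA.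
  have uy : u != y by rewrite eq_sym.
  have := two_hole_bound v a uy.
  rewrite -(ler_pM2l (A_gt0 y b)) => /le_trans; apply.
  by rewrite mulrDr !(mulrCA (A y b)).
(* The 6 is 2 + 4. The first term of [H] needs one triangle inequality, closing up at
   [left_channel a a]. The second needs one through [b] and then [near_total_left_channel], with a
   factor 2 each. *)
have h1 := left_channel_mul a b a; have h2 := left_channel_mul v b a; have h3 := near_total_left_channel u v a.
rewrite left_channel_diag in h1.
have z0 := perfect_total_gt0; have k0 := left_channel_gt0 b a.
have n0 := near_total_gt0 u v; have n1 := near_total_gt0 u a.
have h1' := ler_wpM2l (ltW n0) h1; have h2' := ler_wpM2l (ltW n1) h2.
have h3' := ler_wpM2l (ltW z0) h3; have H' := ler_wpM2l (ltW k0) H.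
lra.
Qed.
End Weights.

(** * The grid of partial switchings *)

Section Arcs.
Variables (T : finType) (s t : {perm T}) (u : T).

Definition arc_pt i : T := ((t * s^-1) ^+ i)%g u.
Let x := arc_pt.
Let k := #|swap_cycle s t u|.

Lemma arc_pt0 : x 0 = u.
Proof. by rewrite /x /arc_pt expg0 perm1. Qed.

Lemma arc_ptS i : s (x i.+1) = t (x i).
Proof. by rewrite /x /arc_pt expgSr !permM permKV. Qed.

Lemma arc_pt_inj i j : (i < k)%N -> (j < k)%N -> x i = x j -> i = j.
Proof.
move=> ik jk; rewrite /x /arc_pt !permX => e.
have := uniq_traject_porbit (t * s^-1)%g u.
move=> /(nth_uniq u); rewrite size_traject => /(_ i j ik jk).
by rewrite !nth_traject // e eqxx => /esym/eqP.
Qed.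

Lemma arc_pt_eq i j : (i < k)%N -> (j < k)%N -> (x i == x j) = (i == j).
Proof. by move=> ik jk; apply/eqP/eqP => [/arc_pt_inj->|->]. Qed.

Lemma arc_pt_mem i : x i \in swap_cycle s t u.
Proof. exact: mem_porbit. Qed.

Lemma arc_ptP z : z \in swap_cycle s t u -> exists2 i, (i < k)%N & z = x i.
Proof.
by rewrite /swap_cycle porbit_traject => /trajectP[i ik ->]; exists i; rewrite // /x /arc_pt permX.
Qed.

Lemma arc_pt_last : s u = t (x k.-1).
Proof.
rewrite -arc_ptS prednK; last by rewrite lt0n card_porbit_neq0.
by rewrite /x /arc_pt permX iter_porbit.
Qed.

Let tw i l := (tperm (x i) (x l) * t)%g.

Lemma twE i l p : (i < k)%N -> (l < k)%N -> (p < k)%N -> tw i l (x p) =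
  if p == i then t (x l) else if p == l then t (x i) else t (x p).
Proof.
move=> ik lk pk; rewrite permM; case: eqP => [->|/eqP pi]; first by rewrite tpermL.
case: eqP => [->|/eqP pl]; first by rewrite tpermR.
by rewrite tpermD // eq_sym arc_pt_eq.
Qed.

Lemma swap_cycle_tw_sub i l z : z \in swap_cycle s (tw i l) u -> z \in swap_cycle s t u.
Proof.
move=> /porbitP[n ->]; elim: n => [|n IH]; first by rewrite expg0 perm1 mem_swap_cycle.
rewrite expgSr permM (permM (tw i l)); set y := fun_of_perm _ u in IH *.
rewrite -(@swap_cycle_eq _ s t u (tperm (x i) (x l) y)); last by rewrite permKV permM.
by case: tpermP => // _; exact: arc_pt_mem.
Qed.

(** Starting at [u], the walk visits the points up to index [i], jumps to index [l + 1] and runs to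
    the end. The transposition splits off the points with indices from [i + 1] to [l], which form
    the cycle of [x l]. For [i = l] there is no cut. *)
Lemma mem_swap_cycle_tw i l p : (i <= l)%N -> (l < k)%N -> (p < k)%N ->
  (x p \in swap_cycle s (tw i l) u) = (p <= i)%N || (l < p)%N.
Proof.
move=> il lk; have ik := leq_ltn_trans il lk.
case: (eqVneq i l) => [->|nil] pk.
  by rewrite /tw tperm1 mul1g arc_pt_mem; case: leqP.
have {il nil} il : (i < l)%N by rewrite ltn_neqAle nil.
set C := swap_cycle s (tw i l) u.
have step y p' q : (p' < k)%N -> (q.+1 < k)%N -> tw i l (x p') = t (x q) ->
    (x p' \in swap_cycle s (tw i l) y) = (x q.+1 \in swap_cycle s (tw i l) y).
  by move=> _ _ e; apply: swap_cycle_eq; rewrite e arc_ptS.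
have in1 q : (q <= i)%N -> x q \in C.
  elim: q => [|q IH] qi; first by rewrite arc_pt0 mem_swap_cycle.
  have qk : (q.+1 < k)%N by exact: leq_ltn_trans qi ik.
  rewrite -(step u q) ?IH ?(ltnW qi) ?(ltnW qk) //.
  rewrite twE ?(ltnW qk) // (ltn_eqF qi) ltn_eqF //.
  exact: ltn_trans qi il.
have in2 q : (l < q)%N -> (q < k)%N -> x q \in C.
  elim: q => // q IH; rewrite ltnS leq_eqVlt => /orP[/eqP <-|lq] qk.
    by rewrite -(step u i) ?in1 // twE // eqxx.
  rewrite -(step u q) ?IH ?(ltnW qk) //.
  by rewrite twE ?(ltnW qk) // !gtn_eqF // (ltn_trans il).
have eqC : C = swap_cycle s (tw i l) (x i) by apply/eqP; rewrite eq_porbit_mem porbit_sym; exact: in1.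
have xlC : x l \notin C.
  rewrite eqC /swap_cycle /tw -mulgA tpermC porbit_tperm_notin //.
    by rewrite arc_pt_eq // gtn_eqF.
  rewrite -/(swap_cycle s t (x i)) (_ : swap_cycle s t (x i) = swap_cycle s t u) ?arc_pt_mem //.
  by apply/eqP; rewrite eq_porbit_mem; exact: arc_pt_mem.
have out q : (i < q)%N -> (q <= l)%N -> x q \in swap_cycle s (tw i l) (x l).
  elim: q => // q IH; rewrite ltnS leq_eqVlt => /orP[/eqP <-|iq] ql.
    by rewrite -(step _ l) ?mem_swap_cycle ?(leq_ltn_trans il) // twE // eqxx gtn_eqF.
  have qk : (q.+1 < k)%N by exact: leq_ltn_trans ql lk.
  rewrite -(step _ q) ?IH ?(ltnW ql) ?(ltnW qk) //.
  by rewrite twE ?(ltnW qk) // gtn_eqF // ltn_eqF.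
case: (leqP p i) => pi; first by rewrite in1.
case: (ltnP l p) => lp; first by rewrite in2.
apply/negP => xpC; move: (out _ pi lp) xlC; rewrite /swap_cycle -eq_porbit_mem => /eqP e.
by rewrite porbit_sym -e porbit_sym xpC.
Qed.

(* The left hole has moved forward to [arc_pt i] and the right hole back to
   [t (arc_pt l)]; the hole edge of [grid i l] is at [arc_pt i].  Cutting the cycle
   of u between these points by a transposition reduces the partial switching to
   a full one. *)
Definition grid i l := flip s (tw i l) u.

Lemma gridE i l p : (i <= l)%N -> (l < k)%N -> (p < k)%N -> grid i l (x p) =
  if (p < i)%N || (l < p)%N then t (x p) else if p == i then t (x l) else s (x p).
Proof.
move=> il lk pk; have ik := leq_ltn_trans il lk.
rewrite flipE mem_swap_cycle_tw // twE // leq_eqVlt orbC orbA.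
case: (ltngtP p i) => pi; rewrite ?orbT ?orbF //=.
- by rewrite ltn_eqF // (leq_trans pi).
- by case: ifP => // lp; rewrite gtn_eqF.
- by rewrite pi ltnNge il.
Qed.

Lemma grid_out i l z : z \notin swap_cycle s t u -> grid i l z = s z.
Proof.
by move=> zC; rewrite flipE ifN //; apply: contra zC; exact: swap_cycle_tw_sub.
Qed.

Lemma eq_grid (f g : {perm T}) : (forall z, z \notin swap_cycle s t u -> f z = g z) ->
  (forall p, (p < k)%N -> f (x p) = g (x p)) -> f = g.
Proof.
move=> h1 h2; apply/permP => z; case: (boolP (z \in swap_cycle s t u)) => [|/h1//].
by move=> /arc_ptP[p pk ->]; exact: h2.
Qed.

Lemma arc_len_gt0 : (0 < k)%N. Proof. by rewrite lt0n card_porbit_neq0. Qed.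

Lemma grid_start : grid 0 k.-1 = s.
Proof.
have k0 := arc_len_gt0; apply: eq_grid => [z|p pk]; first exact: grid_out.
rewrite gridE ?prednK // ltn0 /= leqNgt pk /=.
by case: p pk => [|p] pk //=; rewrite arc_pt0 -arc_pt_last.
Qed.

Lemma grid_diag i : grid i i = flip s t u.
Proof. by rewrite /grid /tw tperm1 mul1g. Qed.

(** A slide of the left hole: the edge joining [x i.+1] to [t (x i)] is replaced by the one joining
    [x i] to [t (x i)]. *)
Lemma grid_left i l : (i < l)%N -> (l < k)%N ->
  grid i.+1 l = (tperm (x i) (x i.+1) * grid i l)%g.
Proof.
move=> il lk; have ik := ltn_trans il lk; have i1k := leq_ltn_trans il lk.
apply: eq_grid => [z zC|p pk].
  rewrite permM tpermD ?grid_out //; apply: contraNneq zC => <-; exact: arc_pt_mem.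
rewrite permM; case: (eqVneq p i) => [->|pi].
  rewrite tpermL !gridE ?(ltnW il) // ltnSn /=.
  by rewrite (_ : (_ < _) || _ = false)%N ?gtn_eqF ?arc_ptS //; lia.
case: (eqVneq p i.+1) => [->|pi1].
  rewrite tpermR !gridE ?(ltnW il) // !ltnn !eqxx /=.
  by rewrite ltnNge il ltnNge (ltnW il).
rewrite tpermD 1?eq_sym ?arc_pt_eq // !gridE ?(ltnW il) // (negbTE pi) (negbTE pi1).
by rewrite ltnS leq_eqVlt (negbTE pi).
Qed.

(** A slide of the right hole: the edge at [x l.+1] turns from [t (x l)] to [t (x l.+1)], while the
    left hole stays at [x i]. *)
Lemma grid_right i l : (i <= l)%N -> (l.+1 < k)%N ->
  grid i l = (tperm (x i) (x l.+1) * grid i l.+1)%g.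
Proof.
move=> il lk; have l'k := ltnW lk; have ik := leq_ltn_trans il l'k.
have il1 : (i <= l.+1)%N by exact: leqW.
apply: eq_grid => [z zC|p pk].
  rewrite permM tpermD ?grid_out //; apply: contraNneq zC => <-; exact: arc_pt_mem.
rewrite permM; case: (eqVneq p i) => [->|pi].
  rewrite tpermL !gridE // ltnn eqxx /= ltnNge il /=.
  by rewrite (_ : (_ < _) || _ = false)%N ?gtn_eqF ?arc_ptS //; lia.
case: (eqVneq p l.+1) => [->|pl].
  by rewrite tpermR !gridE // ltnn eqxx ltnSn orbT ltnNge il1.
rewrite tpermD 1?eq_sym ?arc_pt_eq // !gridE // (negbTE pi).
by rewrite (leq_eqVlt l.+1) eq_sym (negbTE pl).
Qed.

Lemma grid_next i l : (i < l)%N -> (l < k)%N -> grid i l (x i.+1) = t (x i).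
Proof.
move=> il lk; have i1k := leq_ltn_trans il lk.
by rewrite gridE ?(ltnW il) // ltnNge leqnSn ltnNge il /= gtn_eqF // arc_ptS.
Qed.

End Arcs.

(** * Cauchy-Schwarz and the uniform flow on a triangular grid *)

Lemma wsum_sqr_le (R : realFieldType) (I : finType) (P : pred I) (p x : I -> R) :
  (forall i, P i -> 0 <= p i) ->
  (\sum_(i | P i) p i * x i) ^+ 2 <=
  (\sum_(i | P i) p i) * (\sum_(i | P i) p i * x i ^+ 2).
Proof.
move=> p0; set S0 := \sum_(i | P i) p i; set S1 := \sum_(i | P i) p i * x i.
set S2 := \sum_(i | P i) p i * x i ^+ 2.
have S0ge : 0 <= S0 by exact: sumr_ge0.
(* The extra factor [S0] makes the defect a weighted sum of squares without any division; [S0] may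
   be zero, and then every weight is. *)
have H : 0 <= S0 * (S0 * S2 - S1 ^+ 2).
  have -> : S0 * (S0 * S2 - S1 ^+ 2) = \sum_(i | P i) p i * (S0 * x i - S1) ^+ 2.
    transitivity (\sum_(i | P i) (S0 ^+ 2 * (p i * x i ^+ 2)
        - 2 * S0 * S1 * (p i * x i) + S1 ^+ 2 * p i)); last first.
      by apply: eq_bigr => i _; ring.
    rewrite big_split sumrB /= -!mulr_sumr -/S0 -/S1 -/S2; ring.
  by apply: sumr_ge0 => i Pi; rewrite mulr_ge0 ?sqr_ge0 ?p0.
case: (eqVneq S0 0) => [S00|S0n]; last first.
  by rewrite pmulr_rge0 ?subr_ge0 // lt_def S0n in H.
rewrite S00 mul0r (_ : S1 = 0) ?expr0n //.
apply: big1 => i Pi; have /eqP := S00.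
by rewrite psumr_eq0 // => /allP/(_ i); rewrite mem_index_enum Pi => /(_ isT)/eqP->; rewrite mul0r.
Qed.

Section TriangularGrid.
Variables (R : realFieldType) (F : nat -> nat -> R).

Definition level_energy d : R :=
  \sum_(i < d.+1) ((F d i - F d.+1 i.+1) ^+ 2 + (F d i - F d.+1 i) ^+ 2).

Definition level_avg d : R := (\sum_(i < d.+1) F d i) / d.+1%:R.

(* The weights on the right are the flow from the uniform distribution on level d
   to the uniform distribution on level d + 1. *)
Lemma level_avg_diff d :
  level_avg d - level_avg d.+1 =
  \sum_(i < d.+1) ((d.+1%:R - i%:R) / (d.+1%:R * d.+2%:R) * (F d i - F d.+1 i)
     + i.+1%:R / (d.+1%:R * d.+2%:R) * (F d i - F d.+1 i.+1)).
Proof.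
have n1 : d.+1%:R != 0 :> R by rewrite pnatr_eq0.
have n2 : d.+2%:R != 0 :> R by rewrite pnatr_eq0.
have E : \sum_(j < d.+2) F d.+1 j / d.+2%:R =
  \sum_(i < d.+1) (d.+1%:R - i%:R) / (d.+1%:R * d.+2%:R) * F d.+1 i +
  \sum_(i < d.+1) i.+1%:R / (d.+1%:R * d.+2%:R) * F d.+1 i.+1.
  transitivity (\sum_(j < d.+2) (d.+1%:R - j%:R) / (d.+1%:R * d.+2%:R) * F d.+1 j +
     \sum_(j < d.+2) j%:R / (d.+1%:R * d.+2%:R) * F d.+1 j).
    rewrite -big_split /=; apply: eq_bigr => j _.
    by move: (d.+1%:R) (d.+2%:R) n1 n2 => a b n1 n2; field; rewrite n1 n2.
  congr (_ + _); first by rewrite big_ord_recr /= subrr !mul0r addr0.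
  by rewrite big_ord_recl /= !mul0r add0r.
rewrite /level_avg [X in _ - X]mulr_suml E mulr_suml opprD addrA -!sumrB.
apply: eq_bigr => i _; rewrite -[d.+2%:R]natr1 -[i.+1%:R]natr1 in n2 *.
by move: (d.+1%:R) (i%:R) n1 n2 => a b n1 n2; field; rewrite n1 n2.
Qed.

(** Cauchy-Schwarz over the d+1 points of the level, then convexity for the two edges leaving each
    point. With n = d+1 and a the index of the point, their coefficients n - a and a + 1 sum to n +
    1 and are each at most n. *)
Lemma level_avg_diff_sqr d :
  (level_avg d - level_avg d.+1) ^+ 2 <= d.+2%:R^-1 * level_energy d.
Proof.
rewrite level_avg_diff /level_energy.
pose w (i : 'I_d.+1) : R :=
  (d.+1%:R - i%:R) / (d.+1%:R * d.+2%:R) * (F d i - F d.+1 i)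
     + i.+1%:R / (d.+1%:R * d.+2%:R) * (F d i - F d.+1 i.+1).
have := @wsum_sqr_le R 'I_d.+1 predT (fun=> 1) w (fun _ _ => ler01).
under eq_bigr do rewrite mul1r; rewrite sumr_const card_ord.
under [X in _ <= _ * X -> _]eq_bigr do rewrite mul1r.
move=> /le_trans; apply; rewrite !mulr_sumr; apply: ler_sum => i _; rewrite /w.
have id : (i%:R : R) <= d%:R by rewrite ler_nat -ltnS.
have i0 : (0 : R) <= i%:R by [].
set X := F d i - F d.+1 i; set Y := F d i - F d.+1 i.+1.
set n : R := d.+1%:R; have n0 : 0 < n by [].
have nd : n = d%:R + 1 by rewrite natr1.
have -> : d.+2%:R = n + 1 by rewrite natr1.
rewrite -[i.+1%:R]natr1; set a : R := i%:R in i0 id *.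
have -> : n * ((n - a) / (n * (n + 1)) * X + (a + 1) / (n * (n + 1)) * Y) ^+ 2 =
   (n + 1)^-1 * (((n - a) * X + (a + 1) * Y) ^+ 2 / (n * (n + 1))).
  by field; rewrite !gt_eqF //; lra.
rewrite ler_pM2l ?invr_gt0; last by lra.
rewrite ler_pdivrMr; last by nra.
have : 0 <= (n - a) * (a + 1) * (X - Y) ^+ 2.
  by rewrite mulr_ge0 ?sqr_ge0 // mulr_ge0; lra.
have h1 : 0 <= (n - a) * (n + 1) by rewrite mulr_ge0; lra.
have : 0 <= (n + 1) * (a + 1) * X ^+ 2 by rewrite mulr_ge0 ?sqr_ge0 // mulr_ge0; lra.
have : 0 <= (n + 1) * (n - a - 1) * Y ^+ 2 by rewrite mulr_ge0 ?sqr_ge0 // mulr_ge0; lra.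
rewrite !expr2; nra.
Qed.

Lemma triangular_grid_bound m e :
  (F 0 0 - e) ^+ 2 <= 2 * (\sum_(d < m) d.+2%:R^-1) * (\sum_(d < m) level_energy d)
    + 2 * \sum_(i < m.+1) (F m i - e) ^+ 2.
Proof.
(* The differences of level averages telescope. Weighting level d by 1/(d+2), the constant of
   [level_avg_diff_sqr], leaves exactly the harmonic sum. *)
have H1 : (F 0 0 - level_avg m) ^+ 2 <=
    (\sum_(d < m) d.+2%:R^-1) * (\sum_(d < m) level_energy d).
  have -> : F 0 0 - level_avg m =
      \sum_(d < m) d.+2%:R^-1 * (d.+2%:R * (level_avg d - level_avg d.+1)).
    transitivity (\sum_(d < m) (level_avg d - level_avg d.+1)); last first.
      by apply: eq_bigr => d _; rewrite mulKf // pnatr_eq0.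
    elim: m => [|m IH].
      by rewrite big_ord0 /level_avg big_ord_recl big_ord0 addr0 divr1 subrr.
    by rewrite big_ord_recr /= -IH addrA subrK.
  apply: le_trans (wsum_sqr_le _ _) _ => [i _|]; first by rewrite invr_ge0.
  apply: ler_wpM2l; first by apply: sumr_ge0 => i _; rewrite invr_ge0.
  apply: ler_sum => d _.
  have := level_avg_diff_sqr d; rewrite ler_pdivlMl // => /(le_trans _); apply.
  by rewrite exprMn expr2 !mulrA mulVf ?mul1r // pnatr_eq0.
(* Jensen's inequality for the uniform average; the factor 1/(m+1) that it leaves is bounded by
   1. *)
have H2 : (level_avg m - e) ^+ 2 <= \sum_(i < m.+1) (F m i - e) ^+ 2.
  have n0 : (0 : R) < m.+1%:R by [].
  have -> : level_avg m - e = \sum_(i < m.+1) m.+1%:R^-1 * (F m i - e).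
    rewrite -mulr_sumr sumrB sumr_const card_ord mulrBr -[e *+ _]mulr_natl.
    by rewrite mulKf ?gt_eqF // /level_avg mulrC.
  apply: le_trans (wsum_sqr_le _ _) _ => [i _|]; first by rewrite invr_ge0.
  rewrite sumr_const card_ord -[_ *+ _]mulr_natl divff ?gt_eqF // mul1r.
  apply: ler_sum => i _; rewrite ler_piMl ?sqr_ge0 // invf_le1 // ler1n //.
have : (F 0 0 - e) ^+ 2 <= 2 * (F 0 0 - level_avg m) ^+ 2 + 2 * (level_avg m - e) ^+ 2.
  have := sqr_ge0 ((F 0 0 - level_avg m) - (level_avg m - e)); rewrite !expr2; lra.
move=> /le_trans; apply; rewrite -mulrA; apply: lerD; exact: ler_wpM2l.
Qed.

End TriangularGrid.

Lemma sum_injon_le (R : numDomainType) (I J : finType) (h : I -> J)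
    (P : pred I) (Q : pred J) (F : J -> R) :
  {in P &, injective h} -> (forall i, P i -> Q (h i)) -> (forall j, Q j -> 0 <= F j) ->
  \sum_(i | P i) F (h i) <= \sum_(j | Q j) F j.
Proof.
move=> hI PQ F0.
have -> : \sum_(i | P i) F (h i) = \sum_(j in h @: P) F j by rewrite big_imset.
by apply: ler_sum_sub => // j /imsetP[i /PQ Qi ->].
Qed.

(** * Congestion of the slides *)

Section Transpose.
Variables (R : realFieldType) (T : finType) (A : T -> T -> R).
Let At x y := A y x.

(** Inverting the permutation exchanges the two sides of the graph. This substitution transfers the
    bounds for left slides to right slides. *)
Lemma near_total_tr u v : near_total At v u = near_total A u v.
Proof.
rewrite /near_total (reindex_inj invg_inj) /=; apply: eq_big => [s|s /eqP e].
  by rewrite -(inj_eq (@perm_inj _ s)) permKV eq_sym.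
rewrite /near_weight (reindex_inj (@perm_inj _ s)) /=; apply: eq_big => [x|x _].
  by rewrite -[v in LHS](permKV s) e (inj_eq perm_inj).
by rewrite /At permK.
Qed.

Lemma near2_total_tr u y v a : near2_total At v a u y = near2_total A u y v a.
Proof.
rewrite /near2_total (reindex_inj invg_inj) /=; apply: eq_big => [s|s /andP[/eqP e1 /eqP e2]].
  rewrite -(inj_eq (@perm_inj _ s)) permKV eq_sym; congr (_ && _).
  by rewrite -(inj_eq (@perm_inj _ s)) permKV eq_sym.
rewrite /near2_weight (reindex_inj (@perm_inj _ s)) /=; apply: eq_big => [x|x _].
  by rewrite -[v in LHS](permKV s) -[a in LHS](permKV s) e1 e2 !(inj_eq perm_inj).
by rewrite /At permK.
Qed.

Lemma perfect_total_tr : perfect_total At = perfect_total A.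
Proof.
rewrite /perfect_total (reindex_inj invg_inj) /=; apply: eq_bigr => s _.
rewrite /perm_weight (reindex_inj (@perm_inj _ s)) /=; apply: eq_bigr => x _.
by rewrite /At permK.
Qed.

Definition right_channel x y : R := \sum_b A y b * near_total A x b.

Lemma left_channel_tr x y : left_channel At x y = right_channel x y.
Proof. by apply: eq_bigr => b _; rewrite near_total_tr. Qed.

Hypothesis A_gt0 : forall x y, 0 < A x y.

Lemma right_channel_gt0 x y : 0 < right_channel x y.
Proof. by rewrite -left_channel_tr; apply: left_channel_gt0 => p q; exact: A_gt0. Qed.

Lemma channel_bound_tr u v x y :
  right_channel x y * (\sum_(a | a != v) A x a * near2_total A u y v a) <= 6 * perfect_total A * near_total A u v.
Proof.
rewrite -left_channel_tr -perfect_total_tr -near_total_tr.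
under eq_bigr do rewrite -near2_total_tr.
exact: (@channel_bound R T At (fun p q => A_gt0 q p)).
Qed.
End Transpose.

Section Energy.
Variables (R : realFieldType) (T : finType) (A : T -> T -> R).
Hypothesis A_gt0 : forall x y, 0 < A x y.
Variables (gP : {perm T} -> R) (gN : {perm T} -> T -> R).
Implicit Types (s t : {perm T}) (u x y : T).

(** The left hole slides from [x] to the partner of [a]; in [diffR] the edge at [y] turns, so that
    the right hole slides from [s x] to [s y]. *)
Definition diffL s x a : R := 
  (gN s x - gN (tperm x (s^-1 a)%g * s)%g (s^-1 a)%g) ^+ 2.
Definition diffR s x y : R := (gN s x - gN (tperm x y * s)%g x) ^+ 2.

Lemma diffL_ge0 s x a : 0 <= diffL s x a. Proof. exact: sqr_ge0. Qed.
Lemma diffR_ge0 s x y : 0 <= diffR s x y. Proof. exact: sqr_ge0. Qed.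

(** Times [perfect_total / 2], this is the contribution of the slides to the unnormalised Dirichlet
    form at ideal hole weights. The terms with [a = s x] or [y = x] are not moves and vanish. *)
Definition slide_energy : R :=
  \sum_s \sum_x near_weight A s x * (\sum_a A x a / left_channel A (s x) a * diffL s x a
                        + \sum_y A y (s x) / right_channel A x y * diffR s x y).

Definition edge_energy : R := \sum_s perm_weight A s * \sum_x (gN s x - gP s) ^+ 2.

(* Sends (s, t) to the pair of a grid point of s, t and the four-hole matching left
   over from s + t; it is injective for fixed q, which bounds the congestion. *)
Definition tflip u (q : T * T) (p : {perm T} * {perm T}) :=
  flip_pair u (p.1, (tperm q.1 q.2 * p.2)%g).

Lemma tflip_inj u q : injective (tflip u q).
Proof.
apply: (inj_comp (inv_inj (@flip_pairK T u))) => -[s t] [s' t'] /= [<-] /mulgI <-.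
by [].
Qed.

(** Cuts of the cycle at [x i] and [x l] with i < l satisfy this. Phrasing it without the indices
    lets the sum over [q] be exchanged with the sum over pairs. *)
Definition tvalid u (q : T * T) (p : {perm T} * {perm T}) :=
  (q.1 \in swap_cycle p.1 (tperm q.1 q.2 * p.2)%g u) &&
  (q.2 \notin swap_cycle p.1 (tperm q.1 q.2 * p.2)%g u).

(** For a pair [p] in the image of [tflip], [p.2 q.2] is the original [t q.1], the right end of the
    edge that the left slide inserts. Both slides leaving the grid point are thus read off from [p]
    and [q]. *)
Definition qdiff (q : T * T) (p : {perm T} * {perm T}) :=
  diffL p.1 q.1 (p.2 q.2) + diffR p.1 q.1 q.2.

Lemma qdiff_ge0 q p : 0 <= qdiff q p.
Proof. by rewrite addr_ge0 ?diffL_ge0 ?diffR_ge0. Qed.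

(** The superposition splits into the grid point, the four-hole matching and two single edges:
    [(q.1, p.2 q.2)], inserted by the left slide, and [(q.2, p.1 q.1)], inserted by the right
    slide. *)
Lemma tflip_weight u q s t : tvalid u q (s, t) ->
  let p := tflip u q (s, t) in
  near_weight A s u * perm_weight A t =
  near_weight A p.1 q.1 * A q.1 (p.2 q.2) * (A q.2 (p.1 q.1) * near2_weight A p.2 u q.2).
Proof.
case: q => x y /=; rewrite /tvalid /tflip /flip_pair /=.
set t' := (tperm x y * t)%g; set C := swap_cycle s t' u => /andP[/= xC yC].
have yx : y != x by apply: contraNneq yC => ->.
have -> : perm_weight A t = A x (t x) * A y (t y) * near2_weight A t' x y.
  rewrite (perm_weightD1 _ _ x) (near_weightD1 _ _ (_ : x != y)) 1?eq_sym // mulrA; congr (_ * _).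
  by apply: eq_near2_weight => z zx zy; rewrite permM tpermD // eq_sym.
have -> : flip t' s u y = t x by rewrite flipE swap_cycleC (negbTE yC) permM tpermR.
have -> : flip s t' u x = t y by rewrite flipE xC permM tpermL.
rewrite mulrCA /near_weight {2}/near2_weight (flip_weight _ _ _ _ _ u) -/C.
set f := (X in _ * (X * _) = _); set g := (X in _ * (_ * X) = _).
have -> : f = near_weight A (flip s t' u) x.
  apply: eq_bigl => z; case: ifP => zC; first by rewrite (_ : z != y) ?andbT //; apply: contraNneq yC => <-.
  by apply/idP/idP => _; [apply: contraFneq zC => -> | apply: contraFneq zC => ->; exact: mem_swap_cycle].
have -> : g = near2_weight A (flip t' s u) u y.
  apply: eq_bigl => z; case: ifP => zC.
    by rewrite (_ : z != y) ?andbT //; apply: contraNneq yC => <-.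
  have -> : z != x by apply: contraFneq zC => ->.
  by have -> : z != u by apply: contraFneq zC => ->; exact: mem_swap_cycle.
rewrite /near_weight /near2_weight; ring.
Qed.

(** Injectivity of [tflip u q] allows summation over images. For a left slide the edge it inserts
    belongs to its conductance, while the other edge, summed with the four-hole matching, is what
    [channel_bound] controls. Right slides exchange the two roles. *)
Lemma pair_slide_energy u v :
  \sum_(p : {perm T} * {perm T} | p.1 u == v) near_weight A p.1 u * perm_weight A p.2 *
     \sum_(q | tvalid u q p) qdiff q (tflip u q p)
  <= 6 * perfect_total A * near_total A u v * slide_energy.
Proof.
under eq_bigr do rewrite mulr_sumr.
rewrite (exchange_big_dep predT) //=.
pose W (q : T * T) (p : {perm T} * {perm T}) :=
  near_weight A p.1 q.1 * A q.1 (p.2 q.2) * (A q.2 (p.1 q.1) * near2_weight A p.2 u q.2).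
have W0 q p : 0 <= W q p by rewrite !mulr_ge0 ?ltW ?near_weight_gt0 ?near2_weight_gt0.
apply: (@le_trans _ _ (\sum_(q : T * T) \sum_(p : {perm T} * {perm T} |
     (q.2 != u) && (p.2 u == v)) W q p * qdiff q p)).
  apply: ler_sum => q _; apply: (sum_inj_le (@tflip_inj u q)) => [[s t]|[s t]|p _].
  - move=> /andP[/= /eqP su /andP[xC yC]].
    rewrite flipE swap_cycleC mem_swap_cycle su eqxx andbT.
    by apply: contraNneq yC => ->; exact: mem_swap_cycle.
  - by move=> /andP[_ /tflip_weight] ->.
  - by rewrite mulr_ge0 ?qdiff_ge0.
have -> : \sum_(q : T * T) \sum_(p : {perm T} * {perm T} |
     (q.2 != u) && (p.2 u == v)) W q p * qdiff q p =
  \sum_s \sum_x near_weight A s x * (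
    \sum_a A x a * diffL s x a *
       (\sum_(y | y != u) A y (s x) * near2_total A u y v a) +
    \sum_(y | y != u) A y (s x) * diffR s x y *
       (\sum_(a | a != v) A x a * near2_total A u y v a)).
  transitivity (\sum_x \sum_y \sum_s \sum_(t : {perm T} | (y != u) && (t u == v))
      W (x, y) (s, t) * qdiff (x, y) (s, t)).
    rewrite [RHS]pair_bigA /=; apply: eq_bigr => -[x y] _ /=.
    by rewrite [RHS]pair_big_dep /=; apply: eq_big => [[s t]|[s t] _].
  under eq_bigr do rewrite exchange_big; rewrite exchange_big /=.
  apply: eq_bigr => s _; apply: eq_bigr => x _; rewrite mulrDr.
  transitivity (\sum_(y | y != u) \sum_(t : {perm T} | t u == v)
      W (x, y) (s, t) * qdiff (x, y) (s, t)).
    rewrite [RHS]big_mkcond; apply: eq_bigr => y _.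
    by case: (y == u) => //=; rewrite big_pred0_eq.
  have -> : \sum_a A x a * diffL s x a * (\sum_(y | y != u) A y (s x) * near2_total A u y v a) =
     \sum_(y | y != u) \sum_(t : {perm T} | t u == v)
       A x (t y) * diffL s x (t y) * (A y (s x) * near2_weight A t u y).
    under eq_bigr do rewrite mulr_sumr.
    rewrite exchange_big /=; apply: eq_bigr => y _.
    rewrite (partition_big (fun t : {perm T} => t y) predT) //=.
    apply: eq_bigr => a _; rewrite /near2_total !mulr_sumr.
    by apply: eq_bigr => t /andP[_ /eqP ->].
  have -> : \sum_(y | y != u) A y (s x) * diffR s x y *
      (\sum_(a | a != v) A x a * near2_total A u y v a) =
     \sum_(y | y != u) \sum_(t : {perm T} | t u == v)
       A y (s x) * diffR s x y * (A x (t y) * near2_weight A t u y).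
    apply: eq_bigr => y yu; rewrite -[in RHS]mulr_sumr; congr (_ * _).
    rewrite (partition_big (fun t : {perm T} => t y) (fun a => a != v)) /=.
      apply: eq_bigr => a _; rewrite /near2_total mulr_sumr.
      by apply: eq_bigr => t /andP[_ /eqP ->].
    by move=> t /eqP <-; rewrite (inj_eq perm_inj).
  rewrite -mulrDr -big_split mulr_sumr /=; apply: eq_bigr => y _.
  rewrite -big_split mulr_sumr /=; apply: eq_bigr => t _.
  rewrite /W /qdiff /=; ring.
rewrite /slide_energy mulr_sumr; apply: ler_sum => s _.
rewrite mulr_sumr; apply: ler_sum => x _.
rewrite mulrCA ler_pM2l ?near_weight_gt0 // mulrDr; apply: lerD; rewrite [leRHS]mulr_sumr.
  apply: ler_sum => a _.
  have := channel_bound A_gt0 u v a (s x).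
  rewrite -ler_pdivlMl ?left_channel_gt0 // => h.
  have -> : 6 * perfect_total A * near_total A u v * (A x a / left_channel A (s x) a * diffL s x a) =
     A x a * diffL s x a * ((left_channel A (s x) a)^-1 * (6 * perfect_total A * near_total A u v)) by ring.
  by apply: ler_wpM2l => //; rewrite mulr_ge0 ?diffL_ge0 ?diffR_ge0 // ltW.
apply: (@sum_inj_le _ _ id) => // y yu; last first.
  rewrite (mulr_ge0 (mulr_ge0 (mulr_ge0 _ _) _) (mulr_ge0 (divr_ge0 _ _) _)) ?diffR_ge0 //.
  - exact/ltW/perfect_total_gt0.
  - exact/ltW/near_total_gt0.
  - exact/ltW.
  - exact/ltW/right_channel_gt0.
have := channel_bound_tr A_gt0 u v x y.
rewrite -ler_pdivlMl ?right_channel_gt0 // => h.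
have -> : 6 * perfect_total A * near_total A u v * (A y (s x) / right_channel A x y * diffR s x y) =
   A y (s x) * diffR s x y * ((right_channel A x y)^-1 * (6 * perfect_total A * near_total A u v)) by ring.
by apply: ler_wpM2l => //; rewrite mulr_ge0 ?diffL_ge0 ?diffR_ge0 // ltW.
Qed.

(** The flip preserves weight and yields an independent pair again, now with the switched matching
    perfect and the other one with holes [u] and [v]. Only the switched one occurs in the
    summand. *)
Lemma pair_edge_energy u v :
  \sum_(p : {perm T} * {perm T} | p.1 u == v) near_weight A p.1 u * perm_weight A p.2 *
     \sum_(x in swap_cycle p.1 p.2 u) (gN (flip p.1 p.2 u) x - gP (flip p.1 p.2 u)) ^+ 2
  <= near_total A u v * edge_energy.
Proof.
rewrite mulrC /edge_energy sum_mul_pair.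
apply: (sum_inj_le (inv_inj (@flip_pairK T u))) => [[s t]|[s t]|[s t] _] /=.
- by rewrite flipE swap_cycleC mem_swap_cycle.
- move=> _; rewrite [leRHS]mulrAC; apply: ler_pM.
  + by rewrite mulr_ge0 ?ltW ?near_weight_gt0 ?perm_weight_gt0.
  + by apply: sumr_ge0 => x _; exact: sqr_ge0.
  + rewrite /near_weight /perm_weight (flip_weight _ _ _ _ _ u) le_eqVlt; apply/orP; left; apply/eqP.
    congr (_ * _); apply: eq_bigl => x; case: ifP => // xC; [|apply/esym];
      by apply: contraFneq xC => ->; exact: mem_swap_cycle.
  + by apply: ler_sum_sub => // x _; exact: sqr_ge0.
- by rewrite !mulr_ge0 ?sumr_ge0 // ?ltW ?near_weight_gt0 ?perm_weight_gt0 // => x _; exact: sqr_ge0.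
Qed.

Lemma grid_bound s t u :
  (gN s u - gP (flip s t u)) ^+ 2 <=
  2 * (\sum_(d < #|T|.-1) d.+2%:R^-1) *
     (\sum_(q | tvalid u q (s, t)) qdiff q (tflip u q (s, t))) +
  2 * \sum_(x in swap_cycle s t u) (gN (flip s t u) x - gP (flip s t u)) ^+ 2.
Proof.
pose x := arc_pt s t u; set k := #|swap_cycle s t u|; pose m := k.-1.
have kE : k = m.+1 by rewrite prednK // lt0n card_porbit_neq0.
(* Level [d] holds the points reached by [d] slides, [i] of them on the left; the other [d - i]
   bring the right index down from [m] to [m - d + i]. *)
pose F d i := gN (grid s t u i (m - d + i)) (x i).
have F00 : F 0%N 0%N = gN s u by rewrite /F subn0 addn0 grid_start /x arc_pt0.
have Fm i : F m i = gN (flip s t u) (x i) by rewrite /F subnn add0n grid_diag.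
have := triangular_grid_bound F m (gP (flip s t u)).
rewrite F00 => /le_trans; apply; apply: lerD; last first.
  apply: ler_wpM2l => //; under eq_bigr do rewrite Fm.
  apply: (sum_injon_le (h := fun i : 'I_m.+1 => x i)
     (F := fun y => (gN (flip s t u) y - gP (flip s t u)) ^+ 2)) => [i j _ _|i _|y _].
  - by move=> /arc_pt_inj e; apply/val_inj/e; rewrite -/k kE.
  - exact: arc_pt_mem.
  - exact: sqr_ge0.
apply: ler_pM.
- by rewrite mulr_ge0 // sumr_ge0 // => d _; rewrite invr_ge0.
- by apply: sumr_ge0 => d _; apply: sumr_ge0 => i _; rewrite addr_ge0 ?sqr_ge0.
- apply: ler_wpM2l => //.
  have mT : (m <= #|T|.-1)%N by have := max_card (mem (swap_cycle s t u)); rewrite /m /k; case: #|_| => //= j; case: #|_|.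
  rewrite (big_ord_widen _ (fun d => d.+2%:R^-1 : R) mT).
  by apply: ler_sum_sub => // d _; rewrite invr_ge0.
(* A grid point before the hypotenuse is encoded by the two ends of its cut, which are distinct
   points of the cycle. *)
pose h (q : 'I_m * 'I_m) := (x q.2, x (m - q.1 + q.2)%N).
have -> : \sum_(d < m) level_energy F d =
   \sum_(q : 'I_m * 'I_m | (q.2 <= q.1)%N) qdiff (h q) (tflip u (h q) (s, t)).
  transitivity (\sum_(d < m) \sum_(i < m | (i <= d)%N)
     ((F d i - F d.+1 i.+1) ^+ 2 + (F d i - F d.+1 i) ^+ 2)).
    apply: eq_bigr => d _; rewrite /level_energy.
    by rewrite (big_ord_widen _ (fun i => (F d i - F d.+1 i.+1) ^+ 2 + (F d i - F d.+1 i) ^+ 2) (ltn_ord d)).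
  rewrite pair_big_dep /=; apply: eq_bigr => -[d i] /= id.
  have dm := ltn_ord d.
  pose l := (m - d + i)%N.
  have il : (i < l)%N by rewrite /l; lia.
  have lk : (l < k)%N by rewrite kE /l; lia.
  have hL : flip (tperm (x i) (x l) * t)%g s u (x l) = t (x i).
    by rewrite flipE swap_cycleC mem_swap_cycle_tw ?(ltnW il) // ltnn leqNgt il /= permM tpermR.
  have hinv : ((grid s t u i l)^-1)%g (t (x i)) = x i.+1.
    by rewrite -(grid_next il lk) permK.
  rewrite /qdiff /h /= -/l /diffL /diffR hL -/(grid s t u i l) hinv.
  rewrite /F -/l; congr (_ + _); congr (_ ^+ 2); congr (_ - gN _ _).
    by rewrite (_ : (m - d.+1 + i.+1)%N = l) ?grid_left // /l; lia.
  have lE : (m - d.+1 + i).+1 = l by rewrite /l; lia.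
  by rewrite grid_right ?lE //; lia.
apply: (sum_injon_le (h := h) (F := fun q => qdiff q (tflip u q (s, t)))).
- move=> [d i] [d' i'] /= id id' [] e1 e2.
  have := ltn_ord d; have := ltn_ord d' => dm dm'.
  have im : (i < k)%N by rewrite kE; have := ltn_ord i; lia.
  have im' : (i' < k)%N by rewrite kE; have := ltn_ord i'; lia.
  have ii' := arc_pt_inj im im' e1.
  have lk : (m - d + i < k)%N by move: id; rewrite kE unfold_in /=; lia.
  have lk' : (m - d' + i' < k)%N by move: id'; rewrite kE unfold_in /=; lia.
  have ll' := arc_pt_inj lk lk' e2.
  by congr pair; apply: val_inj => //=; lia.
- move=> [d i] /= id; rewrite /tvalid /h /=.
  have dm := ltn_ord d.
  by rewrite !mem_swap_cycle_tw -/k ?kE ?leqnn /= ?ltnn ?orbF; lia.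
- by move=> q _; exact: qdiff_ge0.
Qed.

(** Cauchy-Schwarz over the pairs, then the grid bound for each pair; 12 is the 2 of the grid bound
    times the 6 of [channel_bound]. *)
Lemma hole_poincare u v :
  (\sum_(p : {perm T} * {perm T} | p.1 u == v) near_weight A p.1 u * perm_weight A p.2 *
     (gN p.1 u - gP (flip p.1 p.2 u))) ^+ 2 <=
  near_total A u v ^+ 2 * (12 * (\sum_(d < #|T|.-1) d.+2%:R^-1) * perfect_total A ^+ 2 * slide_energy
         + 2 * perfect_total A * edge_energy).
Proof.
set H := \sum_(d < _) _.
have H0 : 0 <= H by apply: sumr_ge0 => d _; rewrite invr_ge0.
apply: le_trans (wsum_sqr_le _ _) _ => [p _|].
  by rewrite mulr_ge0 ?ltW ?near_weight_gt0 ?perm_weight_gt0.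
have -> : \sum_(p : {perm T} * {perm T} | p.1 u == v) near_weight A p.1 u * perm_weight A p.2
    = near_total A u v * perfect_total A.
  by rewrite sum_mul_pair; apply: eq_bigl => p; rewrite andbT.
have NZ : 0 <= near_total A u v * perfect_total A by rewrite mulr_ge0 ?ltW ?near_total_gt0 ?perfect_total_gt0.
apply: (@le_trans _ _ (near_total A u v * perfect_total A * (2 * H *
    (6 * perfect_total A * near_total A u v * slide_energy) + 2 * (near_total A u v * edge_energy)))).
  apply: ler_wpM2l => //.
  apply: (@le_trans _ _ (2 * H * (\sum_(p : {perm T} * {perm T} | p.1 u == v)
      near_weight A p.1 u * perm_weight A p.2 * \sum_(q | tvalid u q p) qdiff q (tflip u q p))
    + 2 * (\sum_(p : {perm T} * {perm T} | p.1 u == v) near_weight A p.1 u * perm_weight A p.2 *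
     \sum_(x in swap_cycle p.1 p.2 u) (gN (flip p.1 p.2 u) x - gP (flip p.1 p.2 u)) ^+ 2))).
    rewrite mulr_sumr [X in _ <= _ + X]mulr_sumr -big_split /=.
    apply: ler_sum => -[s t] _ /=.
    rewrite !(mulrCA _ (near_weight A s u * perm_weight A t)) -mulrDr.
    apply: ler_wpM2l (grid_bound s t u).
    by rewrite mulr_ge0 ?ltW ?near_weight_gt0 ?perm_weight_gt0.
  apply: lerD; apply: ler_wpM2l => //; first by rewrite mulr_ge0.
    exact: pair_slide_energy.
  exact: pair_edge_energy.
rewrite le_eqVlt; apply/orP; left; apply/eqP; ring.
Qed.

(** Reindexing by the flip shows that the switched matching is distributed like a perfect matching,
    so the mean difference across the grid is a difference of two class means. *)
Lemma pair_mean u v :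
  \sum_(p : {perm T} * {perm T} | p.1 u == v) near_weight A p.1 u * perm_weight A p.2 *
     (gN p.1 u - gP (flip p.1 p.2 u)) =
  (\sum_(s : {perm T} | s u == v) near_weight A s u * gN s u) * perfect_total A -
  near_total A u v * (\sum_s perm_weight A s * gP s).
Proof.
under eq_bigr do rewrite mulrBr.
rewrite sumrB; congr (_ - _).
  rewrite sum_mul_pair; apply: eq_big => [p|p _]; first by rewrite andbT.
  by rewrite mulrAC.
rewrite mulrC sum_mul_pair (reindex_inj (inv_inj (@flip_pairK T u))) /=.
apply: eq_big => [[s t]|[s t] _] /=; first by rewrite flipE swap_cycleC mem_swap_cycle.
rewrite [RHS]mulrAC flipK; congr (_ * _).
rewrite [LHS](flip_weight _ _ _ _ _ u) swap_cycle_flip !flipK.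
congr (_ * _); apply: eq_bigl => x; case: ifP => // xC; [|apply/esym];
  by apply: contraFneq xC => ->; exact: mem_swap_cycle.
Qed.
End Energy.

(** * Time averages of a stationary reversible chain *)

Section ReversibleChain.
Variables (R : realFieldType) (S : finType) (p : S -> R) (P : S -> S -> R).
Hypothesis p_ge0 : forall x, 0 <= p x.
Hypothesis P_ge0 : forall x y, 0 <= P x y.
Hypothesis P_sum1 : forall x, \sum_y P x y = 1.
Hypothesis P_rev : forall x y, p x * P x y = p y * P y x.
Hypothesis P_lazy : forall x, 2^-1 <= P x x.
Implicit Types f g h : S -> R.

Definition mop f : S -> R := fun x => \sum_y P x y * f y.
Definition mopn n f := iter n mop f.
Definition mean_prod f g : R := \sum_x p x * f x * g x.
Definition dirichlet g : R := \sum_x \sum_y p x * P x y * (g x - g y) ^+ 2.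

Lemma mean_prodC f g : mean_prod f g = mean_prod g f.
Proof. by apply: eq_bigr => x _; rewrite mulrAC. Qed.

Lemma mean_prod_mop f g : mean_prod (mop f) g = mean_prod f (mop g).
Proof.
rewrite /mean_prod /mop.
under eq_bigr do rewrite mulr_sumr mulr_suml.
rewrite exchange_big /=; apply: eq_bigr => y _; rewrite mulr_sumr.
apply: eq_bigr => x _; rewrite mulrA P_rev; ring.
Qed.

Lemma mean_prod_mopn a f g : mean_prod (mopn a f) g = mean_prod f (mopn a g).
Proof. by elim: a f g => //= a IH f g; rewrite mean_prod_mop IH /mopn -iterSr. Qed.

Lemma dirichletE g : dirichlet g = 2 * (mean_prod g g - mean_prod g (mop g)).
Proof.
have e1 : \sum_x \sum_y p x * P x y * g x ^+ 2 = mean_prod g g.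
  apply: eq_bigr => x _; rewrite -mulr_suml -mulr_sumr P_sum1; ring.
have e2 : \sum_x \sum_y p x * P x y * g y ^+ 2 = mean_prod g g.
  rewrite -e1 exchange_big /=; apply: eq_bigr => x _; apply: eq_bigr => y _.
  by rewrite P_rev.
have e3 : \sum_x \sum_y p x * P x y * (g x * g y) = mean_prod g (mop g).
  by apply: eq_bigr => x _; rewrite mulr_sumr; apply: eq_bigr => y _; ring.
transitivity (mean_prod g g + mean_prod g g - 2 * mean_prod g (mop g)); last by ring.
rewrite -{1}e1 -e2 -e3 -big_split mulr_sumr -sumrB /=; apply: eq_bigr => x _.
rewrite -big_split mulr_sumr -sumrB /=; apply: eq_bigr => y _; ring.
Qed.

(* Laziness gives [dirichlet g <= 2 * mean_prod g g], as
   [(g x - g y) ^+ 2 <= 2 * (g x ^+ 2 + g y ^+ 2)] and only [y != x] matters. *)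
Lemma mean_prod_mop_ge0 g : 0 <= mean_prod g (mop g).
Proof.
have H : dirichlet g <= 2 * mean_prod g g.
  have off x : \sum_(y | y != x) P x y <= 2^-1.
    have := P_sum1 x; rewrite (bigD1 x) //= => e; have := P_lazy x; lra.
  have e1 : \sum_x \sum_(y | y != x) p x * P x y * g x ^+ 2 <= mean_prod g g / 2.
    rewrite /mean_prod mulr_suml; apply: ler_sum => x _.
    rewrite -mulr_suml -mulr_sumr.
    have := ler_wpM2l (mulr_ge0 (p_ge0 x) (sqr_ge0 (g x))) (off x).
    rewrite expr2; lra.
  have e2 : \sum_x \sum_(y | y != x) p x * P x y * g y ^+ 2 =
      \sum_x \sum_(y | y != x) p x * P x y * g x ^+ 2.
    rewrite (exchange_big_dep predT) //=; apply: eq_bigr => x _.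
    by apply: eq_big => [y|y _]; rewrite 1?eq_sym // P_rev.
  apply: (@le_trans _ _ (2 * (\sum_x \sum_(y | y != x) p x * P x y * g x ^+ 2
     + \sum_x \sum_(y | y != x) p x * P x y * g y ^+ 2))); last by rewrite e2; lra.
  rewrite -big_split mulr_sumr /=; apply: ler_sum => x _.
  rewrite -big_split mulr_sumr (bigD1 x) //= subrr expr0n mulr0 add0r.
  apply: ler_sum => y _; rewrite -mulrDr [leRHS]mulrCA.
  apply: ler_wpM2l; first by rewrite mulr_ge0.
  have := sqr_ge0 (g x + g y); rewrite !expr2; lra.
have := dirichletE g; lra.
Qed.

(** Self-adjointness splits the power in half: an even lag gives a square norm, an odd lag leaves
    one application of the operator, which laziness makes nonnegative. *)
Lemma corr_ge0 n f : 0 <= mean_prod f (mopn n f).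
Proof.
rewrite -(odd_double_half n) -addnn /mopn iterD.
set k := n./2; case: (odd n); rewrite /= iterD -/(mopn k f) -/(mopn k (mopn k f)).
  have -> : mop (mopn k (mopn k f)) = mopn k (mop (mopn k f)).
    by rewrite /mopn -iterSr.
  by rewrite -mean_prod_mopn; exact: mean_prod_mop_ge0.
rewrite -mean_prod_mopn.
by apply: sumr_ge0 => x _; rewrite -mulrA -expr2 mulr_ge0 ?sqr_ge0.
Qed.

Variables (f : S -> R) (K : R).
Hypothesis K_ge0 : 0 <= K.
Hypothesis poincare : forall g, mean_prod f g ^+ 2 <= K * dirichlet g.

(** For the partial sum h of the powers applied to f, h - Ph telescopes to f - P^m f, and the last
    term only lowers the Dirichlet form. Hence D(h) <= 2 <f, h>, and the Poincare hypothesis gives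
    <f, h>^2 <= 2 K <f, h>. *)
Lemma sum_corr_le m : \sum_(t < m) mean_prod f (mopn t f) <= 2 * K.
Proof.
pose h x := \sum_(t < m) mopn t f x.
have fh g : mean_prod g h = \sum_(t < m) mean_prod g (mopn t f).
  by rewrite /mean_prod exchange_big /=; apply: eq_bigr => x _; rewrite mulr_sumr.
have hm x : mop h x = h x - f x + mopn m f x.
  have -> : mop h x = \sum_(t < m) mopn t.+1 f x.
    rewrite /mop /h; under eq_bigr do rewrite mulr_sumr.
    by rewrite exchange_big.
  have e : f x + \sum_(t < m) mopn t.+1 f x = h x + mopn m f x.
    by rewrite /h -(big_ord_recr m (fun t => mopn t f x)) big_ord_recl.
  lra.
have Dh : dirichlet h <= 2 * mean_prod f h.
  rewrite dirichletE ler_pM2l //.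
  have -> : mean_prod h h - mean_prod h (mop h) = mean_prod h f - mean_prod h (mopn m f).
    rewrite -!sumrB; apply: eq_bigr => x _; rewrite hm; ring.
  rewrite mean_prodC gerBl mean_prodC fh; apply: sumr_ge0 => t _.
  by rewrite mean_prod_mopn /mopn -iterD corr_ge0.
rewrite -fh; have := le_trans (poincare h) (ler_wpM2l K_ge0 Dh).
have := K_ge0; set c := mean_prod f h => K0 H.
rewrite leNgt; apply/negP => cK; have : 0 < c * (c - 2 * K) by rewrite mulr_gt0; lra.
rewrite expr2 in H; lra.
Qed.

(** With truncated subtraction the exponent is the distance of [s] and [t]. For fixed [s], the times
    up to [s] and the times after [s] each produce any lag at most once. *)
Lemma sum_sum_corr_le T :
  \sum_(s < T) \sum_(t < T) mean_prod f (mopn (s - t + (t - s)) f) <= 4 * K * T%:R.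
Proof.
have H (s : 'I_T) : \sum_(t < T) mean_prod f (mopn (s - t + (t - s)) f) <= 4 * K.
  rewrite (bigID (fun t : 'I_T => (t <= s)%N)) /=.
  rewrite (_ : 4 * K = 2 * K + 2 * K); last by ring.
  apply: lerD.
    apply: le_trans (sum_corr_le T).
    pose h (t : 'I_T) := Ordinal (leq_ltn_trans (leq_subr t s) (ltn_ord s)).
    apply: le_trans (sum_injon_le (h := h) (P := fun t : 'I_T => (t <= s)%N) (Q := predT)
      (F := fun r : 'I_T => mean_prod f (mopn r f)) _ _ _).
    - by apply: ler_sum => t ts; rewrite (eqP (ts : (t - s == 0)%N)) addn0.
    - move=> t t'; rewrite !unfold_in /= => ts ts' [] e.
      by apply: val_inj => /=; lia.
    - by [].
    - by move=> r _; exact: corr_ge0.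
  apply: le_trans (sum_corr_le T).
  pose h (t : 'I_T) := Ordinal (leq_ltn_trans (leq_subr s t) (ltn_ord t)).
  apply: le_trans (sum_injon_le (h := h) (P := fun t : 'I_T => ~~ (t <= s)%N) (Q := predT)
    (F := fun r : 'I_T => mean_prod f (mopn r f)) _ _ _).
  - apply: ler_sum => t; rewrite -ltnNge => /ltnW ts.
    by rewrite (eqP (ts : (s - t == 0)%N)) add0n.
  - move=> t t'; rewrite !unfold_in /= => ts ts' [] e.
    by apply: val_inj => /=; lia.
  - by [].
  - by move=> r _; exact: corr_ge0.
have -> : 4 * K * T%:R = \sum_(s < T) 4 * K by rewrite sumr_const card_ord mulr_natr.
by apply: ler_sum => s _; exact: H.
Qed.
End ReversibleChain.

(** * Moments of the chain from its path probabilities *)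

Section SimpleIntegral.
Variables (R : realType) (d : measure_display) (Om : measurableType d).
Variable Pr : probability Om R.

Lemma integral_simple (U : finType) (B : U -> set Om) (c : U -> R) :
  (forall z, measurable (B z)) ->
  (\int[Pr]_om (\sum_z c z * \1_(B z) om)%R%:E)%E =
  (\sum_z c z * fine (Pr (B z)))%:E.
Proof.
move=> mB.
transitivity (\int[Pr]_om (\sum_z (c z)%:E * (\1_(B z) om)%:E)%E)%E.
  by apply: eq_integral => om _; rewrite -sumEFin.
rewrite (@integral_sum _ _ _ Pr setT measurableT U
  (fun z om => ((c z)%:E * (\1_(B z) om)%:E)%E)); last first.
  by move=> z; apply: integrableZl => //; exact: integrable_indic.
rewrite -sumEFin; apply: eq_bigr => z _.
rewrite integralZl //; last exact: integrable_indic.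
by rewrite integral_indic // setIT EFinM fineK // fin_num_measure.
Qed.

Lemma prob_split (U : finType) (A : set Om) (Z : Om -> U) :
  measurable A -> (forall z, measurable [set om | Z om = z]%classic) ->
  fine (Pr A) = \sum_z fine (Pr (A `&` [set om | Z om = z])%classic).
Proof.
move=> mA mZ.
have mB z : measurable (A `&` [set om | Z om = z])%classic by exact: measurableI.
have H := integral_simple (fun=> 1) mB.
under eq_bigr do rewrite -[fine _]mul1r.
apply: EFin_inj; rewrite -H.
rewrite fineK ?fin_num_measure // -{1}[A]setIT -integral_indic //.
apply: eq_integral => om _; congr (_%:E).
under eq_bigr do rewrite mul1r indicI.
rewrite (bigD1 (Z om)) //= big1 => [|z /eqP zn]; last first.
  by rewrite [X in _ * X]indicE memNset ?mulr0 // => /esym.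
by rewrite addr0 [X in _ * X]indicE mem_set ?mulr1.
Qed.
End SimpleIntegral.

Section ChainMoments.
Variables (R : realType) (S : finType) (p : S -> R) (P : S -> S -> R).
Hypothesis P_sum1 : forall x, \sum_y P x y = 1.
Hypothesis P_rev : forall x y, p x * P x y = p y * P y x.
Variables (d : measure_display) (Om : measurableType d) (Pr : probability Om R).
Variable X : nat -> Om -> S.
Hypothesis chain : markov_chain p P Pr X.

Definition past t (x : nat -> S) : set Om :=
  [set om | forall i, (i <= t)%N -> X i om = x i]%classic.
Definition extend t (x : nat -> S) z : nat -> S := fun i => if i == t then z else x i.

Lemma measurable_state t z : measurable [set om | X t om = z]%classic.
Proof. by case: chain. Qed.

Lemma past_extend t x z :
  past t.+1 (extend t.+1 x z) = (past t x `&` [set om | X t.+1 om = z])%classic.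
Proof.
apply/seteqP; split => om /=.
  move=> h; split=> [i it|]; last by rewrite h // /extend eqxx.
  by rewrite h ?leqW // /extend ltn_eqF.
move=> [h e] i; rewrite /extend leq_eqVlt; case: eqP => [-> //|_ /=].
exact: h.
Qed.

Lemma measurable_past t x : measurable (past t x).
Proof.
elim: t => [|t IH].
  rewrite (_ : past 0 x = [set om | X 0 om = x 0]%classic).
    exact: measurable_state.
  apply/seteqP; split => om /=; first by apply.
  by move=> e [|i].
rewrite (_ : past t.+1 x = past t.+1 (extend t.+1 x (x t.+1))).
  by rewrite past_extend; apply: measurableI => //; exact: measurable_state.
by apply/seteqP; split => om h i it; rewrite h // /extend; case: eqP => [->|].
Qed.

Lemma past_split t x (C : set Om) : measurable C ->
  fine (Pr (past t x `&` C)%classic) =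
  \sum_z fine (Pr (past t.+1 (extend t.+1 x z) `&` C)%classic).
Proof.
move=> mC; rewrite (@prob_split _ _ _ _ _ _ (X t.+1)).
- by apply: eq_bigr => z _; rewrite past_extend setIAC.
- by apply: measurableI => //; exact: measurable_past.
- by move=> z; exact: measurable_state.
Qed.

Lemma past_step t x z :
  fine (Pr (past t.+1 (extend t.+1 x z))) = fine (Pr (past t x)) * P (x t) z.
Proof.
case: chain => _ _ H; rewrite /past (H t (extend t.+1 x z)) fineM //; last first.
  by apply: fin_num_measure; exact: measurable_past.
rewrite /= /extend eqxx ltn_eqF //; congr (fine (Pr _) * _).
by apply/seteqP; split => om h i it; rewrite h // ltn_eqF.
Qed.

Lemma past_state t x y :
  fine (Pr (past t x `&` [set om | X t om = y])%classic) =
  (y == x t)%:R * fine (Pr (past t x)).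
Proof.
case: eqP => [->|ne]; rewrite ?mul1r ?mul0r.
  by rewrite (setIidl _) // => om /= ->.
rewrite (_ : _ `&` _ = set0)%classic ?measure0 //.
by apply/seteqP; split => om //= [h e]; apply: ne; rewrite -e h.
Qed.

(** The Markov property is given for complete histories only, so the induction extends the history
    by one state and sums over that state. *)
Lemma future_mean g k t x :
  \sum_y g y * fine (Pr (past t x `&` [set om | X (t + k) om = y])%classic) =
  fine (Pr (past t x)) * mopn P k g (x t).
Proof.
elim: k t x => [|k IH] t x.
  rewrite addn0 (bigD1 (x t)) //= big1 => [|y /negbTE yn]; last first.
    by rewrite past_state yn mul0r mulr0.
  by rewrite past_state eqxx mul1r addr0 mulrC.
under eq_bigr => y _.
  rewrite past_split ?mulr_sumr; last exact: measurable_state.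
  over.
rewrite exchange_big /= /mop mulr_sumr; apply: eq_bigr => z _.
rewrite addnS -addSn IH past_step -mulrA; congr (_ * (_ * _)).
by rewrite /extend eqxx.
Qed.

Lemma future_pair_mean f g s k t x :
  \sum_y \sum_y' f y * g y' * fine (Pr (past t x `&`
      ([set om | X (t + s) om = y] `&` [set om | X (t + s + k) om = y']))%classic) =
  fine (Pr (past t x)) * mopn P s (fun y => f y * mopn P k g y) (x t).
Proof.
elim: s t x => [|s IH] t x.
  rewrite addn0 (bigD1 (x t)) //= [X in _ + X]big1 => [|y /negbTE yn]; last first.
    apply: big1 => y' _; rewrite setIA (_ : _ `&` _ = set0)%classic ?measure0 ?mulr0 //.
    apply/seteqP; split => om //= [[h e] _]; move: yn; rewrite -e h //.
    by rewrite eqxx.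
  rewrite addr0 mulrCA -future_mean mulr_sumr; apply: eq_bigr => y _.
  by rewrite mulrA setIA (setIidl (_ : past t x `<=` [set om | X t om = x t])%classic) // => om /= ->.
under eq_bigr => y _.
  under eq_bigr => y' _.
    rewrite past_split ?mulr_sumr; last by apply: measurableI; exact: measurable_state.
    over.
  rewrite exchange_big; over.
rewrite exchange_big /= [mop _ _ _]/mop mulr_sumr; apply: eq_bigr => z _.
rewrite addnS -addSn IH past_step -mulrA; congr (_ * (_ * _)).
by rewrite /extend eqxx.
Qed.

Lemma mop_mean h : \sum_x p x * mop P h x = \sum_x p x * h x.
Proof.
have e g : \sum_x p x * g x = mean_prod p (fun=> 1) g.
  by apply: eq_bigr => x _; rewrite mulr1.
rewrite !e -mean_prod_mop //; apply: eq_bigr => x _; congr (_ * _ * _).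
by rewrite /mop -[RHS](P_sum1 x); apply: eq_bigr => y _; rewrite mulr1.
Qed.

Lemma mopn_mean k h : \sum_x p x * mopn P k h x = \sum_x p x * h x.
Proof. by elim: k => //= k IH; rewrite mop_mean. Qed.

(** Condition on the state at time 0, a history of length one; stationarity then removes the first
    [s] steps. *)
Lemma pair_moment f g s k :
  \sum_y \sum_y' f y * g y' * fine (Pr
      ([set om | X s om = y] `&` [set om | X (s + k) om = y'])%classic) =
  mean_prod p f (mopn P k g).
Proof.
under eq_bigr => y _.
  under eq_bigr => y' _.
    rewrite (@prob_split _ _ _ _ _ _ (X 0)) ?mulr_sumr; last 2 first.
    - by apply: measurableI; exact: measurable_state.
    - by move=> z; exact: measurable_state.
    over.
  rewrite exchange_big; over.
rewrite exchange_big /=.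
transitivity (\sum_z p z * mopn P s (fun y => f y * mopn P k g y) z).
  apply: eq_bigr => z _.
  have <- : fine (Pr (past 0 (fun=> z))) = p z.
    have -> : past 0 (fun=> z) = [set om | X 0 om = z]%classic.
      by apply/seteqP; split => om /=; [apply | move=> e [|i]].
    by case: chain => _ -> _.
  rewrite -future_pair_mean; apply: eq_bigr => y _; apply: eq_bigr => y' _.
  rewrite !add0n setIC; congr (_ * fine (Pr (_ `&` _)%classic)).
  by apply/seteqP; split => om /=; [move=> e [|i] | apply].
by rewrite mopn_mean; apply: eq_bigr => z _; rewrite mulrA.
Qed.

Lemma pair_moment_sym f s t :
  \sum_y \sum_y' f y * f y' * fine (Pr
      ([set om | X s om = y] `&` [set om | X t om = y'])%classic) =
  mean_prod p f (mopn P (s - t + (t - s)) f).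
Proof.
have H a b : (a <= b)%N -> \sum_y \sum_y' f y * f y' * fine (Pr
      ([set om | X a om = y] `&` [set om | X b om = y'])%classic) =
    mean_prod p f (mopn P (b - a) f).
  by move=> ab; rewrite -(pair_moment f f a) subnKC.
case: (leqP s t) => [st|/ltnW ts].
  by rewrite H // (eqP (st : (s - t == 0)%N)) add0n.
rewrite (eqP (ts : (t - s == 0)%N)) addn0 -H // exchange_big /=.
by apply: eq_bigr => y _; apply: eq_bigr => y' _; rewrite setIC mulrAC mulrC mulrA.
Qed.

Lemma state_mean f t :
  \sum_y f y * fine (Pr [set om | X t om = y]%classic) = \sum_x p x * f x.
Proof.
have := pair_moment f (fun=> 1) t 0; rewrite addn0 /mean_prod /= => e.
transitivity (\sum_x p x * f x * 1); last by apply: eq_bigr => x _; rewrite mulr1.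
rewrite -e; apply: eq_bigr => y _; rewrite (bigD1 y) //= big1 => [|z zy].
  by rewrite setIid mulr1 addr0.
rewrite (_ : _ `&` _ = set0)%classic ?measure0 ?mulr0 //.
apply/seteqP; split => om //= [e1 e2]; move: zy; rewrite -e1 -e2.
by rewrite eqxx.
Qed.

Lemma state_value (f : S -> R) t om :
  f (X t om) = \sum_y f y * (\1_[set om | X t om = y]%classic om : R).
Proof.
rewrite (bigD1 (X t om)) //= big1 => [|y /eqP yn].
  by rewrite indicE mem_set // mulr1 addr0.
by rewrite indicE memNset ?mulr0 // => /esym.
Qed.

Lemma variance_time_average f0 T : (0 < T)%N ->
  let f x := f0 x - \sum_z p z * f0 z in
  ('V_Pr[fun om => (T%:R^-1 * \sum_(0 <= t < T) f0 (X t om))%R])%E =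
  (T%:R^-1 ^+ 2 * \sum_(s < T) \sum_(t < T) mean_prod p f (mopn P (s - t + (t - s)) f))%:E.
Proof.
move=> T0 f; set m := \sum_z p z * f0 z in f *.
have Tn : T%:R != 0 :> R by rewrite pnatr_eq0 -lt0n.
have mean : ('E_Pr[fun om => (T%:R^-1 * \sum_(0 <= t < T) f0 (X t om))%R] = m%:E)%E.
  rewrite unlock.
  have := @integral_simple R d Om Pr ('I_T * S)%type
    (fun q => [set om | X q.1 om = q.2]%classic) (fun q => T%:R^-1 * f0 q.2)
    (fun q => measurable_state q.1 q.2).
  rewrite -(pair_bigA _ (fun (t : 'I_T) y => T%:R^-1 * f0 y * fine (Pr [set om | X t om = y]%classic))) /=.
  under [X in _ = X%:E -> _]eq_bigr => t _.
    under eq_bigr do rewrite -mulrA.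
    rewrite -mulr_sumr state_mean; over.
  rewrite sumr_const card_ord -[(T%:R^-1 * _) *+ _]mulr_natl mulVKf // => <-.
  apply: eq_integral => om _; congr (_%:E).
  rewrite big_mkord mulr_sumr.
  rewrite -(pair_bigA _ (fun (t : 'I_T) y => T%:R^-1 * f0 y * \1_[set om | X t om = y]%classic om)) /=.
  apply: eq_bigr => t _; rewrite state_value mulr_sumr.
  by apply: eq_bigr => y _; rewrite mulrA.
rewrite /variance unlock mean /= unlock.
(* The squared deviation is a finite combination of indicators of these events, so only two-time
   probabilities enter the variance. *)
pose B (q : ('I_T * 'I_T) * (S * S)) :=
  ([set om | X q.1.1 om = q.2.1] `&` [set om | X q.1.2 om = q.2.2])%classic.
have mB q : measurable (B q) by apply: measurableI; exact: measurable_state.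
have sum4 (G : ('I_T * 'I_T) * (S * S) -> R) :
    \sum_q G q = \sum_(s < T) \sum_(t < T) \sum_y \sum_y' G ((s, t), (y, y')).
  transitivity (\sum_a \sum_b G (a, b)).
    by rewrite pair_bigA /=; apply: eq_bigr => -[].
  rewrite [RHS]pair_bigA /=; apply: eq_bigr => -[s t] _ /=.
  by rewrite [RHS]pair_bigA /=; apply: eq_bigr => -[].
transitivity ((\sum_q T%:R^-1 ^+ 2 * (f q.2.1 * f q.2.2) * fine (Pr (B q)))%:E); last first.
  congr (_%:E); rewrite sum4 mulr_sumr; apply: eq_bigr => s _.
  rewrite mulr_sumr; apply: eq_bigr => t _.
  rewrite -pair_moment_sym mulr_sumr; apply: eq_bigr => y _.
  by rewrite mulr_sumr; apply: eq_bigr => y' _; rewrite -mulrA.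
rewrite -integral_simple //; apply: eq_integral => om _; congr (_%:E).
have -> : (((fun om => T%:R^-1 * \sum_(0 <= t < T) f0 (X t om)) \- cst m)
    * ((fun om => T%:R^-1 * \sum_(0 <= t < T) f0 (X t om)) \- cst m)) om
    = (T%:R^-1 * \sum_(t < T) f (X t om)) ^+ 2.
  rewrite expr2; have -> : T%:R^-1 * \sum_(t < T) f (X t om) =
     T%:R^-1 * (\sum_(0 <= t < T) f0 (X t om)) - m; last by [].
  rewrite big_mkord /f sumrB sumr_const card_ord mulrBr; congr (_ - _).
  by rewrite -/m -[m *+ _]mulr_natl mulKf.
rewrite exprMn sum4 [(\sum_(t < T) _) ^+ 2]expr2 mulr_suml mulr_sumr; apply: eq_bigr => s _.
rewrite mulr_sumr mulr_sumr; apply: eq_bigr => t _.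
rewrite (state_value f s) (state_value f t) mulr_suml mulr_sumr; apply: eq_bigr => y _.
rewrite mulr_sumr mulr_sumr; apply: eq_bigr => y' _.
by rewrite /B /= indicI /=; ring.
Qed.

End ChainMoments.

(** * Matchings as permutations *)

Section MatchingsAsPermutations.
Variables (V1 V2 : finType) (beta : V1 -> V2) (gamma : V2 -> V1).
Hypotheses (betaK : cancel beta gamma) (gammaK : cancel gamma beta).
Implicit Types (s : {perm V1}) (u x : V1) (v a : V2) (M : {set V1 * V2}).

Definition edge s x : V1 * V2 := (x, beta (s x)).
Definition full s : {set V1 * V2} := [set edge s x | x in [set: V1]]%SET.
(** The right hole is [beta (s u)]; the pair [(s, u)] determines, and is determined by, the
    near-perfect matching. *)
Definition holed s u : {set V1 * V2} := [set edge s x | x in [set~ u]]%SET.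

Lemma beta_inj : injective beta. Proof. exact: can_inj betaK. Qed.

Lemma edge_inj s : injective (edge s). Proof. by move=> x y []. Qed.

Lemma mem_full s e : (e \in full s) = (e.2 == beta (s e.1)).
Proof.
apply/imsetP/eqP => [[x _ ->] //|]; case: e => x a /= ->.
by exists x; rewrite ?inE.
Qed.

Lemma mem_holed s u e : (e \in holed s u) = (e.1 != u) && (e.2 == beta (s e.1)).
Proof.
apply/imsetP/andP => [[x]|[]]; first by rewrite !inE => xu ->; rewrite eqxx.
case: e => x a /= xu /eqP ->; by exists x; rewrite ?inE.
Qed.

Lemma holedE s u : holed s u = (full s :\ edge s u)%SET.
Proof.
apply/setP => -[x a]; rewrite !inE mem_full mem_holed /= /edge xpair_eqE.
by case: eqVneq => //= ->; rewrite andNb.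
Qed.

Lemma fullU s u : full s = (edge s u |: holed s u)%SET.
Proof. by rewrite holedE finset.setD1K // mem_full. Qed.

Lemma card_holed s u : #|holed s u| = #|V1|.-1.
Proof. by rewrite card_imset ?cardsC1 //; exact: edge_inj. Qed.

Lemma full_inj : injective full.
Proof.
move=> s t e; apply/permP => x; apply: beta_inj; apply/eqP.
by rewrite -[beta (s x)]/(edge s x).2 -[x in t x]/(edge s x).1 -mem_full -e mem_full.
Qed.

Lemma matching_full s : is_matching (full s).
Proof.
apply/forallP => -[x a]; apply/implyP; rewrite mem_full /= => /eqP ->.
apply/forallP => -[y b]; apply/implyP; rewrite mem_full /= => /eqP ->.
apply/implyP => /orP[/eqP -> //|]; by rewrite (inj_eq beta_inj) (inj_eq perm_inj) => /eqP ->.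
Qed.

Lemma matching_sub (M M' : {set V1 * V2}) : M \subset M' -> is_matching M' -> is_matching M.
Proof.
move=> /fintype.subsetP sub /forallP m; apply/forallP => e; apply/implyP => eM.
apply/forallP => f; apply/implyP => fM.
by have /implyP/(_ (sub _ eM))/forallP/(_ f)/implyP/(_ (sub _ fM)) := m e.
Qed.

Lemma matching_holed s u : is_matching (holed s u).
Proof. by apply: matching_sub (matching_full s); rewrite holedE finset.subsetDl. Qed.

Lemma full_perfect s : full s \in perfect_matchings V1 V2.
Proof.
rewrite inE matching_full /=; apply/andP; split; apply/eqP/setP => z; rewrite !inE.
  by apply/existsP; exists (beta (s z)); rewrite mem_full.
by apply/existsP; exists (s^-1 (gamma z))%g; rewrite mem_full /= permKV gammaK.
Qed.

Lemma holed_near s u : holed s u \in near_matchings u (beta (s u)).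
Proof.
rewrite inE matching_holed card_holed eqxx /=.
apply/andP; split; apply/eqP/setP => z; rewrite !inE.
  apply/negP/eqP => [h|-> /existsP[v]]; last by rewrite mem_holed /= eqxx.
  apply/eqP/negPn/negP => zu; apply: h.
  by apply/existsP; exists (beta (s z)); rewrite mem_holed /= zu eqxx.
apply/negP/eqP => [h|-> /existsP[x]]; last first.
  by rewrite mem_holed /= (inj_eq beta_inj) (inj_eq perm_inj) eq_sym andNb.
apply/eqP/negPn/negP => zu; apply: h; apply/existsP; exists (s^-1 (gamma z))%g.
rewrite mem_holed /= permKV gammaK eqxx andbT; apply: contraNneq zu => <-.
by rewrite permKV gammaK.
Qed.

Lemma matchingP M e f : is_matching M -> e \in M -> f \in M ->
  (e.1 = f.1) \/ (e.2 = f.2) -> e = f.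
Proof.
move=> /forallP/(_ e)/implyP h /h /forallP/(_ f)/implyP h' /h' /implyP h2 h3.
by apply/eqP/h2; case: h3 => ->; rewrite eqxx ?orbT.
Qed.

Lemma perfectP M : reflect (exists s, M = full s) (M \in perfect_matchings V1 V2).
Proof.
apply: (iffP idP) => [|[s ->]]; last exact: full_perfect.
rewrite inE => /and3P[mM /eqP c1 _].
have ex x : exists v, (x, v) \in M.
  have : x \in covered1 M by rewrite c1 inE.
  by rewrite inE => /existsP.
pose f x := gamma (xchoose (ex x)).
have fM x : (x, beta (f x)) \in M by rewrite gammaK; exact: (xchooseP (ex x)).
have f_inj : injective f.
  move=> x y e; have /= h := matchingP mM (fM x) (fM y).
  by have [] : (x, beta (f x)) = (y, beta (f y)) by apply: h; right; rewrite e.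
exists (perm f_inj); apply/setP => -[x a]; rewrite mem_full /= permE.
apply/idP/eqP => [xa|->//].
have /= h := matchingP mM xa (fM x).
by have [] : (x, a) = (x, beta (f x)) by apply: h; left.
Qed.

Lemma nearP M u v :
  reflect (exists2 s : {perm V1}, beta (s u) = v & M = holed s u) (M \in near_matchings u v).
Proof.
apply: (iffP idP) => [|[s <- ->]]; last exact: holed_near.
rewrite inE => /and4P[mM _ /eqP/setP c1 /eqP/setP c2].
have n1 e : e \in M -> e.1 != u.
  case: e => x a xa /=; have := c1 x; rewrite !inE => <-; rewrite negbK.
  by apply/existsP; exists a.
have n2 e : e \in M -> e.2 != v.
  case: e => x a xa /=; have := c2 a; rewrite !inE => <-; rewrite negbK.
  by apply/existsP; exists x.
(* Adding the hole edge gives a perfect matching, whose permutation is the one sought. *)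
have : ((u, v) |: M)%SET \in perfect_matchings V1 V2.
  rewrite inE; apply/and3P; split.
  - apply/forallP => e; apply/implyP; rewrite !inE => eM.
    apply/forallP => f; apply/implyP; rewrite !inE => fM.
    apply/implyP => ef.
    case/orP: eM => [/eqP eE|eM]; case/orP: fM => [/eqP fE|fM].
    + by rewrite eE fE.
    + by move: ef; rewrite eE /= (eq_sym u) (eq_sym v) (negbTE (n1 _ fM)) (negbTE (n2 _ fM)).
    + by move: ef; rewrite fE /= (negbTE (n1 _ eM)) (negbTE (n2 _ eM)).
    + by apply/eqP/(matchingP mM eM fM); case/orP: ef => /eqP; [left|right].
  - apply/eqP/setP => x; rewrite !inE; have := c1 x; rewrite !inE.
    case: eqP => [-> _|_ /negbFE/existsP[a xa]]; apply/existsP.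
      by exists v; rewrite !inE eqxx.
    by exists a; rewrite !inE xa orbT.
  - apply/eqP/setP => a; rewrite !inE; have := c2 a; rewrite !inE.
    case: eqP => [-> _|_ /negbFE/existsP[x xa]]; apply/existsP.
      by exists u; rewrite !inE eqxx.
    by exists x; rewrite !inE xa orbT.
case/perfectP => s sE.
have sv : beta (s u) = v.
  have : (u, v) \in full s by rewrite -sE !inE eqxx.
  by rewrite mem_full => /eqP.
exists s => //; rewrite holedE -sE /edge sv finset.setU1K //.
by apply/negP => /n1; rewrite eqxx.
Qed.

Lemma near_holed s u u' v : (holed s u \in near_matchings u' v) = (u' == u) && (v == beta (s u)).
Proof.
apply/idP/andP => [|[/eqP -> /eqP ->]]; last exact: holed_near.
have := holed_near s u; rewrite !inE => /and4P[_ _ /eqP c1 /eqP c2] /and4P[_ _].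
by rewrite c1 c2 !(inj_eq finset.set1_inj) eq_sym => -> ; rewrite eq_sym.
Qed.

Lemma holed_not_perfect s u : holed s u \notin perfect_matchings V1 V2.
Proof.
apply/negP => /perfectP[t e].
have : edge t u \in full t by rewrite mem_full.
by rewrite -e mem_holed eqxx.
Qed.

Lemma full_not_near s u v : full s \notin near_matchings u v.
Proof.
by apply/negP => /nearP[t _ e]; have := holed_not_perfect t u; rewrite -e full_perfect.
Qed.

Lemma eq_holed s u s' u' : (holed s u == holed s' u') = (u == u') && (s == s').
Proof.
apply/eqP/andP => [e|[/eqP -> /eqP ->] //].
have := holed_near s' u'; rewrite -e near_holed => /andP[/eqP uu /eqP vv].
rewrite uu; split => //; apply/eqP/full_inj.
by rewrite (fullU s u) (fullU s' u') e uu /edge -vv uu.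
Qed.

Lemma eq_full s s' : (full s == full s') = (s == s').
Proof. by apply/eqP/eqP => [/full_inj ->|->]. Qed.

Lemma eq_full_holed s s' u' : (full s == holed s' u') = false.
Proof. by apply/eqP => e; have := holed_not_perfect s' u'; rewrite -e full_perfect. Qed.

Lemma spaceP M : reflect ((exists s, M = full s) \/ (exists s u, M = holed s u))
  (M \in matching_space V1 V2).
Proof.
rewrite inE; apply: (iffP orP) => [[/perfectP|]|[/perfectP|[s [u ->]]]]; try by left.
  move=> /bigcupP[u _ /bigcupP[v _ /nearP[s _ ->]]]; right; by exists s, u.
by right; apply/bigcupP; exists u => //; apply/bigcupP; exists (beta (s u)) => //; exact: holed_near.
Qed.

Lemma full_space s : full s \in matching_space V1 V2.
Proof. by apply/spaceP; left; exists s. Qed.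

Lemma holed_space s u : holed s u \in matching_space V1 V2.
Proof. by apply/spaceP; right; exists s, u. Qed.

Lemma slide_left_target s u x : x != u ->
  ((u, beta (s x)) |: (holed s u :\ edge s x))%SET = holed (tperm u x * s)%g x.
Proof.
move=> xu; apply/setP => -[y a]; rewrite !inE !mem_holed /= /edge !xpair_eqE permM.
case: (eqVneq y u) => [->|yu] /=; first by rewrite tpermL (eq_sym u x) (negbTE xu) andbF orbF.
case: (eqVneq y x) => [->|yx] /=; first by rewrite andNb.
by rewrite tpermD 1?eq_sym.
Qed.

Lemma slide_right_target s u x : x != u ->
  ((x, beta (s u)) |: (holed s u :\ edge s x))%SET = holed (tperm u x * s)%g u.
Proof.
move=> xu; apply/setP => -[y a]; rewrite !inE !mem_holed /= /edge !xpair_eqE permM.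
case: (eqVneq y x) => [->|yx] /=; first by rewrite tpermR xu andNb orbF.
case: (eqVneq y u) => [->|yu] //=.
by rewrite tpermD 1?eq_sym.
Qed.

Section Sums.
Variable R : numDomainType.

Lemma sum_edges_full (F : V1 * V2 -> R) s : \sum_(e in full s) F e = \sum_x F (edge s x).
Proof.
rewrite big_imset /=; last by move=> x y _ _; exact: edge_inj.
by apply: eq_bigl => x; rewrite inE.
Qed.

Lemma sum_edges_holed (F : V1 * V2 -> R) s u :
  \sum_(e in holed s u) F e = \sum_(x | x != u) F (edge s x).
Proof.
rewrite big_imset /=; last by move=> x y _ _; exact: edge_inj.
by apply: eq_bigl => x; rewrite !inE.
Qed.

Lemma sum_perfect (F : {set V1 * V2} -> R) :
  \sum_(M in perfect_matchings V1 V2) F M = \sum_s F (full s).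
Proof.
have -> : perfect_matchings V1 V2 = [set full s | s in [set: {perm V1}]]%SET.
  by apply/setP => M; apply/perfectP/imsetP => [[s ->]|[s _ ->]]; exists s.
rewrite big_imset /=; last by move=> x y _ _; exact: full_inj.
by apply: eq_bigl => x; rewrite inE.
Qed.

Lemma sum_near (F : {set V1 * V2} -> R) u v :
  \sum_(M in near_matchings u v) F M = \sum_(s : {perm V1} | beta (s u) == v) F (holed s u).
Proof.
have -> : near_matchings u v = [set holed s u | s in [set s : {perm V1} | beta (s u) == v]]%SET.
  apply/setP => M; apply/nearP/imsetP => [[s e ->]|[s]]; first by exists s; rewrite ?inE ?e.
  by rewrite inE => /eqP e ->; exists s.
rewrite big_imset /=.
  by apply: eq_bigl => s; rewrite inE.
by move=> s t _ _ /eqP; rewrite eq_holed eqxx => /eqP.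
Qed.

Lemma sum_state (F : {set V1 * V2} -> R) :
  \sum_(M : state V1 V2) F (val M) = \sum_s F (full s) + \sum_u \sum_s F (holed s u).
Proof.
have -> : \sum_(M : state V1 V2) F (val M) = \sum_(M in matching_space V1 V2) F M.
  rewrite -(@big_imset _ _ _ _ _ val predT F) /=; last by move=> x y _ _; exact: val_inj.
  apply: eq_bigl => M; apply/imsetP/idP => [[m _ ->]|MS]; first exact: valP.
  by exists (Sub M MS); rewrite ?SubK.
rewrite (bigID (fun M => M \in perfect_matchings V1 V2)) /= -sum_perfect; congr (_ + _).
  apply: eq_bigl => M; apply/andP/idP => [[]//|/perfectP[s ->]].
  by rewrite full_space full_perfect.
rewrite pair_bigA /= -(@big_imset _ _ _ _ _ (fun q : V1 * {perm V1} => holed q.2 q.1) predT F) /=; last first.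
  by move=> [u s] [u' s'] _ _ /eqP; rewrite eq_holed => /= /andP[/eqP -> /eqP ->].
apply: eq_bigl => M; apply/andP/imsetP => [[/spaceP[[s ->]|[s [u ->]]]]|[[u s] _ ->]] /=.
- by rewrite full_perfect.
- by exists (u, s).
- by rewrite holed_space holed_not_perfect.
Qed.

Lemma sum_target (F : {set V1 * V2} -> R) (t : {set V1 * V2}) (c : R) :
  t \in matching_space V1 V2 ->
  \sum_(M : state V1 V2) (if val M == t then c else 0) * F (val M) = c * F t.
Proof.
move=> tS; rewrite (bigD1 (Sub t tS : state V1 V2)) //= eqxx big1 ?addr0 // => M ne.
rewrite ifN ?mul0r //; apply: contra ne => /eqP e.
Qed.
End Sums.
End MatchingsAsPermutations.

(** * The hole-weighted slide chain *)

Section HWSChain.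
Variables (R : realType) (V1 V2 : finType) (beta : V1 -> V2) (gamma : V2 -> V1).
Hypotheses (betaK : cancel beta gamma) (gammaK : cancel gamma beta).
Variables (lam w : V1 * V2 -> R).
Hypothesis lam_gt0 : forall e, 0 < lam e.
Hypothesis roughP : rough lam w.
Hypothesis n_gt1 : (1 < #|V1|)%N.
Implicit Types (s t : {perm V1}) (u x y v a : V1) (M : {set V1 * V2}).

Let n : R := #|V1|%:R.
Let A x y := lam (x, beta y).
Let Wt u v := total_weight lam w u (beta v).
Let L v a := slideL lam w (beta v) (beta a).
Let Rs u x := slideR lam w u x.
Notation full := (full beta).
Notation holed := (holed beta).
Let Binj := beta_inj betaK.

Let A_gt0 x y : 0 < A x y. Proof. exact: lam_gt0. Qed.
Let w_gt0 e : 0 < w e. Proof. by case: roughP. Qed.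
Let n_gt0 : 0 < n. Proof. by rewrite ltr0n (ltn_trans _ n_gt1). Qed.

Lemma sum_beta (F : V2 -> R) : \sum_b F b = \sum_y F (beta y).
Proof. by rewrite (reindex beta) //; exists gamma => z _. Qed.

Lemma sum_beta_neq (F : V2 -> R) v : \sum_(b | b != beta v) F b = \sum_(y | y != v) F (beta y).
Proof.
rewrite (reindex beta) /=; last by exists gamma => z _.
by apply: eq_bigl => y; rewrite (inj_eq Binj).
Qed.

Lemma activity_full s : activity lam (full s) = perm_weight A s.
Proof.
rewrite /activity big_imset /=; last by move=> x y _ _; exact: edge_inj.
by apply: eq_bigl => x; rewrite inE.
Qed.

Lemma activity_holed s u : activity lam (holed s u) = near_weight A s u.
Proof.
rewrite /activity big_imset /=; last by move=> x y _ _; exact: edge_inj.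
by apply: eq_bigl => x; rewrite !inE.
Qed.

Lemma activity_perfect : activity_set lam (perfect_matchings V1 V2) = perfect_total A.
Proof.
rewrite /activity_set (sum_perfect betaK gammaK).
by apply: eq_bigr => s _; exact: activity_full.
Qed.

Lemma activity_near u v : activity_set lam (near_matchings u (beta v)) = near_total A u v.
Proof.
rewrite /activity_set (sum_near betaK gammaK).
apply: eq_big => [s|s _]; first by rewrite (inj_eq Binj).
exact: activity_holed.
Qed.

Lemma rough_bounds u v :
  w (u, beta v) * near_total A u v <= 2 * perfect_total A /\ perfect_total A <= 2 * (w (u, beta v) * near_total A u v).
Proof.
case: roughP => _ /(_ u (beta v)); rewrite /ideal_hole_weight.
rewrite activity_perfect activity_near => /andP[].
have z0 := perfect_total_gt0 A_gt0; have n0 := near_total_gt0 A_gt0 u v.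
have -> : w (u, beta v) / (perfect_total A / near_total A u v) = w (u, beta v) * near_total A u v / perfect_total A.
  by rewrite invf_div mulrA.
rewrite ler_pdivlMr // ler_pdivrMr // => h1 h2.
split; lra.
Qed.

Lemma inv_bound (S Z K : R) : 0 < S -> 0 < Z -> 0 < K -> S * Z <= 2 * K ->
  K^-1 <= 2 / Z * S^-1.
Proof.
move=> S0 Z0' K0 h; have -> : 2 / Z * S^-1 = K^-1 * (2 * K / (S * Z)).
  by field; rewrite !lt0r_neq0.
apply: ler_peMr; first by rewrite invr_ge0 ltW.
by rewrite ler_pdivlMr ?mul1r // mulr_gt0.
Qed.

(** Roughness puts each [1 / w (z, v)] within a factor 2 of [near_total z v / perfect_total], and
    the factor survives summation and inversion. The lower bounds on the slide rates serve the
    comparison of energies, the upper bounds the normalising constant. *)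
Lemma slideL_lower v a : a != v -> (left_channel A v a)^-1 <= 2 / perfect_total A * L v a.
Proof.
move=> av; rewrite /L /slideL (inj_eq Binj) (negbTE av) /=.
have z0 := perfect_total_gt0 A_gt0; have k0 := left_channel_gt0 A_gt0 v a.
have S0 : 0 < \sum_z A z a / w (z, beta v).
  by rewrite (bigD1 a) //= ltr_wpDr ?divr_gt0 // sumr_ge0 // => z _; rewrite divr_ge0 // ltW.
apply: inv_bound => //; rewrite mulr_suml mulr_sumr; apply: ler_sum => z _.
rewrite -mulrA [leRHS]mulrCA; apply: ler_wpM2l; first exact/ltW.
rewrite mulrC ler_pdivrMr //.
by have [_] := rough_bounds z v; rewrite [w _ * _]mulrC mulrA.
Qed.

Lemma slideL_upper v a : a != v -> left_channel A v a * L v a <= 2 * perfect_total A.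
Proof.
move=> av; rewrite /L /slideL (inj_eq Binj) (negbTE av) /=.
have z0 := perfect_total_gt0 A_gt0; have k0 := left_channel_gt0 A_gt0 v a.
have S0 : 0 < \sum_z A z a / w (z, beta v).
  by rewrite (bigD1 a) //= ltr_wpDr ?divr_gt0 // sumr_ge0 // => z _; rewrite divr_ge0 // ltW.
rewrite ler_pdivrMr // mulr_sumr; apply: ler_sum => z _.
rewrite mulrCA ler_pM2l // ler_pdivlMr // mulrC.
by have [] := rough_bounds z v.
Qed.

Lemma slideRE u x : x != u -> Rs u x = (\sum_y A x y / w (u, beta y))^-1.
Proof. by move=> xu; rewrite /Rs /slideR (negbTE xu) sum_beta. Qed.

Lemma slideR_lower u x : x != u -> (right_channel A u x)^-1 <= 2 / perfect_total A * Rs u x.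
Proof.
move=> xu; rewrite slideRE //.
have z0 := perfect_total_gt0 A_gt0; have k0 := right_channel_gt0 A_gt0 u x.
have S0 : 0 < \sum_y A x y / w (u, beta y).
  by rewrite (bigD1 x) //= ltr_wpDr ?divr_gt0 // sumr_ge0 // => z _; rewrite divr_ge0 // ltW.
apply: inv_bound => //; rewrite mulr_suml mulr_sumr; apply: ler_sum => z _.
rewrite -mulrA [leRHS]mulrCA; apply: ler_wpM2l; first exact/ltW.
rewrite mulrC ler_pdivrMr //.
by have [_] := rough_bounds u z; rewrite [w _ * _]mulrC mulrA.
Qed.

Lemma slideR_upper u x : x != u -> right_channel A u x * Rs u x <= 2 * perfect_total A.
Proof.
move=> xu; rewrite slideRE //.
have z0 := perfect_total_gt0 A_gt0; have k0 := right_channel_gt0 A_gt0 u x.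
have S0 : 0 < \sum_y A x y / w (u, beta y).
  by rewrite (bigD1 x) //= ltr_wpDr ?divr_gt0 // sumr_ge0 // => z _; rewrite divr_ge0 // ltW.
rewrite ler_pdivrMr // mulr_sumr; apply: ler_sum => z _.
rewrite mulrCA ler_pM2l // ler_pdivlMr // mulrC.
by have [] := rough_bounds u z.
Qed.

Lemma slideL_ge0 v a : 0 <= L v a.
Proof.
rewrite /L /slideL; case: ifP => // _; rewrite invr_ge0 sumr_ge0 // => z _.
by rewrite divr_ge0 // ltW.
Qed.

Lemma slideR_ge0 u x : 0 <= Rs u x.
Proof.
rewrite /Rs /slideR; case: ifP => // _; rewrite invr_ge0 sumr_ge0 // => z _.
by rewrite divr_ge0 // ltW.
Qed.

Lemma total_weightE u v : Wt u v = w (u, beta v) + n * A u v +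
  \sum_(a | a != v) A u a * L v a + \sum_(x | x != u) A x v * Rs u x.
Proof. by rewrite /Wt /total_weight /sumL sum_beta_neq. Qed.

Lemma Wt_gt0 u v : 0 < Wt u v.
Proof.
rewrite total_weightE -!addrA ltr_wpDr //; apply: addr_ge0.
  by rewrite mulr_ge0 // ltW.
by apply: addr_ge0; apply: sumr_ge0 => z _; rewrite mulr_ge0 ?slideL_ge0 ?slideR_ge0 // ltW.
Qed.

Lemma sum_holes (F : V1 -> V2 -> R) s u :
  \sum_u' \sum_(v : V2 | holed s u \in near_matchings u' v) F u' v = F u (beta (s u)).
Proof.
rewrite (bigD1 u) //= (big_pred1 (beta (s u))) => [|v]; last first.
  by rewrite /= (near_holed betaK gammaK) eqxx.
rewrite big1 ?addr0 // => u' u'u; rewrite big1 // => v.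
by rewrite (near_holed betaK gammaK) (negbTE u'u).
Qed.

Definition set_weight M : R :=
  if M \in perfect_matchings V1 V2 then #|V1|%:R ^+ 2 * activity lam M
  else \sum_(u : V1) \sum_(v : V2 | M \in near_matchings u v)
         total_weight lam w u v * activity lam M.

Lemma set_weight_full s : set_weight (full s) = n ^+ 2 * perm_weight A s.
Proof. by rewrite /set_weight (full_perfect betaK gammaK) activity_full. Qed.

Lemma set_weight_holed s u : set_weight (holed s u) = Wt u (s u) * near_weight A s u.
Proof.
rewrite /set_weight (negbTE (holed_not_perfect betaK gammaK s u)).
by rewrite (sum_holes (fun u (v : V2) => total_weight lam w u v * _)) activity_holed.
Qed.

Lemma move_full s M : hws_move lam w (full s) M =
  \sum_x (if M == holed s x then (2 * n)^-1 else 0).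
Proof.
rewrite /hws_move (full_perfect betaK gammaK) sum_edges_full.
by apply: eq_bigr => x _; rewrite -holedE.
Qed.

Lemma move_holed s u M : hws_move lam w (holed s u) M =
  (if M == full s then n * A u (s u) / (2 * Wt u (s u)) else 0) +
  \sum_(x | x != u)
    ((if M == holed (tperm u x * s)%g x
      then A u (s x) * L (s u) (s x) / (2 * Wt u (s u)) else 0) +
     (if M == holed (tperm u x * s)%g u
      then A x (s u) * Rs u x / (2 * Wt u (s u)) else 0)).
Proof.
rewrite /hws_move (negbTE (holed_not_perfect betaK gammaK s u)).
pose G u' (v' : V2) : R := (if M == ((u', v') |: holed s u)%SET
        then #|V1|%:R * lam (u', v') / (2 * total_weight lam w u' v') else 0)
       + \sum_(e in holed s u)
           ((if M == ((u', e.2) |: (holed s u :\ e))%SET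
             then lam (u', e.2) * slideL lam w v' e.2
                    / (2 * total_weight lam w u' v') else 0)
            + (if M == ((e.1, v') |: (holed s u :\ e))%SET
               then lam (e.1, v') * slideR lam w u' e.1
                      / (2 * total_weight lam w u' v') else 0)).
rewrite (sum_holes G) /G -fullU; congr (_ + _).
rewrite sum_edges_holed; apply: eq_bigr => x xu.
by rewrite /= (slide_left_target beta s xu) (slide_right_target beta s xu).
Qed.

Lemma sum_move_full (F : {set V1 * V2} -> R) s :
  \sum_(M : state V1 V2) hws_move lam w (full s) (val M) * F (val M) =
  (2 * n)^-1 * \sum_x F (holed s x).
Proof.
under eq_bigr do rewrite move_full mulr_suml.
rewrite exchange_big mulr_sumr /=; apply: eq_bigr => x _.
by rewrite sum_target //; exact: holed_space.
Qed.

Lemma sum_move_holed (F : {set V1 * V2} -> R) s u :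
  \sum_(M : state V1 V2) hws_move lam w (holed s u) (val M) * F (val M) =
  (2 * Wt u (s u))^-1 * (n * A u (s u) * F (full s) +
  \sum_(x | x != u) (A u (s x) * L (s u) (s x) * F (holed (tperm u x * s)%g x) +
     A x (s u) * Rs u x * F (holed (tperm u x * s)%g u))).
Proof.
under eq_bigr do rewrite move_holed mulrDl mulr_suml.
move: (Wt u (s u)) => W.
rewrite big_split exchange_big /= mulrDr mulr_sumr sum_target; last exact: full_space.
congr (_ + _); first by rewrite mulrAC mulrC.
apply: eq_bigr => x _; under eq_bigr do rewrite mulrDl.
rewrite big_split /= !sum_target; try exact: holed_space.
by move: ((2 * W)^-1) => c; ring.
Qed.

Lemma move_ge0 (M M' : state V1 V2) : 0 <= hws_move lam w (val M) (val M').
Proof.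
have /(spaceP betaK gammaK) [[s ->]|[s [u ->]]] := valP M.
  by rewrite move_full sumr_ge0 // => x _; case: ifP; rewrite // invr_ge0 mulr_ge0 // ltW.
have W0 := Wt_gt0 u (s u).
rewrite move_holed addr_ge0 //.
  by case: ifP => // _; rewrite divr_ge0 ?mulr_ge0 // ltW.
apply: sumr_ge0 => x _; apply: addr_ge0; case: ifP => // _;
  by rewrite divr_ge0 ?mulr_ge0 ?slideL_ge0 ?slideR_ge0 // ltW.
Qed.

Lemma sum_move_le (M : state V1 V2) :
  \sum_(M' : state V1 V2) hws_move lam w (val M) (val M') <= 2^-1.
Proof.
under eq_bigr do rewrite -[hws_move _ _ _ _]mulr1.
have /(spaceP betaK gammaK) [[s ->]|[s [u ->]]] := valP M.
  rewrite (sum_move_full (fun=> 1)) sumr_const -/n invfM -mulrA mulVf ?mulr1 //.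
  exact: lt0r_neq0.
have W0 := Wt_gt0 u (s u).
rewrite (sum_move_holed (fun=> 1)) mulr1.
have : n * A u (s u) + \sum_(x | x != u)
   (A u (s x) * L (s u) (s x) * 1 + A x (s u) * Rs u x * 1) <= Wt u (s u).
  under eq_bigr do rewrite !mulr1.
  rewrite total_weightE big_split /= addrA lerD2r.
  (* The moves index left slides by the left end [x] of the removed edge, the total weight by its
     right end [s x]. The summand [w] of the total weight is pure slack. *)
  rewrite [X in _ <= _ + X](reindex_inj (@perm_inj _ s)) /=.
  under [X in _ <= _ + X]eq_bigl do rewrite (inj_eq perm_inj).
  by rewrite lerD2r lerDr ltW.
move: (Wt u (s u)) W0 => W W0 h.
by rewrite mulrC ler_pdivrMr ?mulr_gt0 // mulrA mulVf ?mul1r // pnatr_eq0.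
Qed.

Lemma cancel_weight (W a c : R) : 0 < W -> W * a * (c / (2 * W)) = a * c / 2.
Proof. by move=> W0; field; rewrite !lt0r_neq0. Qed.

(** The total weights cancel. A left slide and its reverse lead to the same edge set once the
    inserted edge is added, and L_v(a) depends only on [v] and [a], both unchanged; right slides are
    symmetric. Deletion and insertion both give n/2 times the activity of the perfect matching. *)
Lemma set_weight_move_sym (M M' : state V1 V2) :
  set_weight (val M) * hws_move lam w (val M) (val M') =
  set_weight (val M') * hws_move lam w (val M') (val M).
Proof.
have FH s s' u' : set_weight (full s) * hws_move lam w (full s) (holed s' u') =
    set_weight (holed s' u') * hws_move lam w (holed s' u') (full s).
  rewrite set_weight_full set_weight_holed move_full move_holed.
  have W0 := Wt_gt0 u' (s' u').
  rewrite [X in _ = _ * (_ + X)]big1 => [|x _]; last first.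
    by rewrite !(eq_full_holed betaK gammaK) addr0.
  rewrite addr0 (eq_full betaK).
  under eq_bigr do rewrite (eq_holed betaK gammaK).
  rewrite (bigD1 u') //= big1 ?addr0 => [|x]; last by rewrite eq_sym => /negbTE ->.
  rewrite eqxx /= eq_sym; case: eqP => [->|]; last by rewrite !mulr0.
  rewrite (perm_weightD1 A s' u'); move: (Wt u' (s' u')) W0 => W W0.
  field; rewrite !lt0r_neq0 //.
have /(spaceP betaK gammaK) [[s ->]|[s [u ->]]] := valP M;
  have /(spaceP betaK gammaK) [[s' ->]|[s' [u' ->]]] := valP M'.
- rewrite !move_full !big1 ?mulr0 // => x _; by rewrite (eq_full_holed betaK gammaK).
- exact: FH.
- exact/esym/FH.
rewrite !set_weight_holed !move_holed.
rewrite ![holed _ _ == full _]eq_sym !(eq_full_holed betaK gammaK) !add0r.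
have W0 := Wt_gt0 u (s u); have W0' := Wt_gt0 u' (s' u').
have fact2 r a b : a != b -> near_weight A r a = A b (r b) * near2_weight A r a b by move=> ab; exact: near_weightD1.
(* With equal left holes only right slides can connect the two matchings; with different ones only a
   left slide can. *)
case: (eqVneq u u') => [<-|uu'].
  under eq_bigr => x xu.
    rewrite !(eq_holed betaK gammaK) eqxx (eq_sym u) (negbTE xu) /= add0r; over.
  under [in RHS]eq_bigr => x xu.
    rewrite !(eq_holed betaK gammaK) eqxx (eq_sym u) (negbTE xu) /= add0r; over.
  rewrite !mulr_sumr; apply: eq_bigr => x xu.
  have -> : (s == tperm u x * s')%g = (s' == tperm u x * s)%g.
    by apply/eqP/eqP => ->; rewrite mulgA tperm2 mul1g.
  case: eqP => [s'E|_]; last by rewrite !mulr0.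
  have su : s' u = s x by rewrite s'E permM tpermL.
  have sx : s' x = s u by rewrite s'E permM tpermR.
  have ux : u != x by rewrite eq_sym.
  have wE : near2_weight A s' u x = near2_weight A s u x.
    by apply: eq_near2_weight => y yu yx; rewrite s'E permM tpermD // eq_sym.
  rewrite !cancel_weight ?Wt_gt0 // (fact2 _ _ x) // (fact2 s' _ x) // su sx wE; ring.
rewrite (bigD1 u') 1?eq_sym // big1 ?addr0 => [|x /andP[_ xu']]; last first.
  by rewrite !(eq_holed betaK gammaK) (eq_sym u') (negbTE xu') (eq_sym u') (negbTE uu') addr0.
rewrite [in RHS](bigD1 u) // big1 ?addr0 => [|x /andP[_ xu]]; last first.
  by rewrite !(eq_holed betaK gammaK) (eq_sym u) (negbTE xu) (negbTE uu') addr0.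
rewrite !(eq_holed betaK gammaK) !eqxx (negbTE uu') (eq_sym u') (negbTE uu') /= !addr0.
have -> : (s == tperm u' u * s')%g = (tperm u u' * s == s')%g.
  by rewrite tpermC; apply/eqP/eqP => [->|<-]; rewrite mulgA tperm2 mul1g.
case: eqP => [/esym s'E|_]; last by rewrite !mulr0.
have su : s' u = s u' by rewrite s'E permM tpermL.
have sx : s' u' = s u by rewrite s'E permM tpermR.
have wE : near2_weight A s' u' u = near2_weight A s u u'.
  by rewrite near2_weightC; apply: eq_near2_weight => y yu yx; rewrite s'E permM tpermD // eq_sym.
rewrite !cancel_weight ?Wt_gt0 // (fact2 _ _ u') // (fact2 s' _ u) 1?eq_sym // su sx wE; ring.
Qed.

Let p := pi_HWS lam w.
Let P := P_HWS lam w.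
Let Zt : R := \sum_(M : state V1 V2) hws_weight lam w M.

Lemma hws_weightE (M : state V1 V2) : hws_weight lam w M = set_weight (val M).
Proof. by []. Qed.

Lemma sum_set_weight (F : {set V1 * V2} -> R) :
  \sum_(M : state V1 V2) set_weight (val M) * F (val M) =
  n ^+ 2 * (\sum_s perm_weight A s * F (full s)) +
  \sum_u \sum_v Wt u v * (\sum_(s : {perm V1} | s u == v) near_weight A s u * F (holed s u)).
Proof.
rewrite (sum_state betaK gammaK (fun M => set_weight M * F M)) mulr_sumr; congr (_ + _).
  by apply: eq_bigr => s _; rewrite set_weight_full mulrA.
apply: eq_bigr => u _; rewrite (partition_big (fun s : {perm V1} => s u) predT) //=.
apply: eq_bigr => v _; rewrite mulr_sumr; apply: eq_bigr => s /eqP <-.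
by rewrite set_weight_holed mulrA.
Qed.

Lemma total_weight_sum : Zt = n ^+ 2 * perfect_total A + \sum_u \sum_v Wt u v * near_total A u v.
Proof.
rewrite /Zt; under eq_bigr do rewrite hws_weightE -[set_weight _]mulr1.
rewrite (sum_set_weight (fun=> 1)); congr (_ * _ + _).
  by apply: eq_bigr => s _; rewrite mulr1.
apply: eq_bigr => u _; apply: eq_bigr => v _; congr (_ * _).
by apply: eq_bigr => s _; rewrite mulr1.
Qed.

Lemma total_weight_gt0 : 0 < Zt.
Proof.
rewrite total_weight_sum ltr_wpDr ?mulr_gt0 ?exprn_gt0 ?perfect_total_gt0 //.
apply: sumr_ge0 => u _; apply: sumr_ge0 => v _.
by rewrite mulr_ge0 // ltW ?Wt_gt0 ?near_total_gt0.
Qed.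

(** 8 = 1 + 2 + 1 + 2 + 2: the perfect matchings, then the summands w, n lambda, D^L and D^R of the
    total weight. The third is exact by [left_channel_diag]; the 2s come from roughness. *)
Lemma total_weight_upper : Zt <= 8 * n ^+ 2 * perfect_total A.
Proof.
have z0 := perfect_total_gt0 A_gt0.
have card2 (c : R) : \sum_(u : V1) \sum_(v : V1) c = n ^+ 2 * c.
  by rewrite !sumr_const -[c *+ _]mulr_natl -[(_ * c) *+ _]mulr_natl mulrA -expr2.
have h1 : \sum_u \sum_v w (u, beta v) * near_total A u v <= n ^+ 2 * (2 * perfect_total A).
  rewrite -card2; apply: ler_sum => u _; apply: ler_sum => v _.
  by have [] := rough_bounds u v.
have h2 : \sum_u \sum_v n * A u v * near_total A u v = n ^+ 2 * perfect_total A.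
  rewrite exchange_big /= -card2; apply: eq_bigr => v _.
  under eq_bigr do rewrite -mulrA.
  by rewrite -mulr_sumr -/(left_channel A v v) left_channel_diag // sumr_const -[perfect_total A *+ _]mulr_natl.
have h3 : \sum_u \sum_v (\sum_(a | a != v) A u a * L v a) * near_total A u v <= n ^+ 2 * (2 * perfect_total A).
  rewrite -card2 exchange_big; apply: ler_sum => v _.
  under eq_bigr do rewrite mulr_suml.
  rewrite exchange_big /=; apply: (sum_inj_le (h := id)) => // a av; last first.
    by rewrite mulr_ge0 // ltW.
  rewrite (le_trans _ (slideL_upper av)) // /left_channel mulr_suml le_eqVlt; apply/orP; left.
  by apply/eqP/eq_bigr => z _; rewrite mulrAC.
have h4 : \sum_u \sum_v (\sum_(x | x != u) A x v * Rs u x) * near_total A u v <= n ^+ 2 * (2 * perfect_total A).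
  rewrite -card2; apply: ler_sum => u _.
  under eq_bigr do rewrite mulr_suml.
  rewrite exchange_big /=; apply: (sum_inj_le (h := id)) => // x xu; last first.
    by rewrite mulr_ge0 // ltW.
  rewrite (le_trans _ (slideR_upper xu)) // /right_channel mulr_suml le_eqVlt; apply/orP; left.
  by apply/eqP/eq_bigr => z _; rewrite mulrAC.
have -> : Zt = n ^+ 2 * perfect_total A + (\sum_u \sum_v w (u, beta v) * near_total A u v +
   \sum_u \sum_v n * A u v * near_total A u v +
   \sum_u \sum_v (\sum_(a | a != v) A u a * L v a) * near_total A u v +
   \sum_u \sum_v (\sum_(x | x != u) A x v * Rs u x) * near_total A u v).
  rewrite total_weight_sum; congr (_ + _).
  rewrite -!big_split /=; apply: eq_bigr => u _.
  rewrite -!big_split /=; apply: eq_bigr => v _.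
  by rewrite total_weightE !mulrDl.
rewrite h2; lra.
Qed.

Lemma pi_ge0 (M : state V1 V2) : 0 <= p M.
Proof.
rewrite /p /pi_HWS divr_ge0 ?(ltW total_weight_gt0) // hws_weightE.
have /(spaceP betaK gammaK) [[s ->]|[s [u ->]]] := valP M.
  by rewrite set_weight_full mulr_ge0 ?exprn_ge0 ?ltW ?perm_weight_gt0.
by rewrite set_weight_holed mulr_ge0 ?ltW ?Wt_gt0 ?near_weight_gt0.
Qed.

Lemma pi_sum1 : \sum_(M : state V1 V2) p M = 1.
Proof. by rewrite -mulr_suml mulfV // lt0r_neq0 // total_weight_gt0. Qed.

Lemma P_sum1 (M : state V1 V2) : \sum_(M' : state V1 V2) P M M' = 1.
Proof.
rewrite /P /P_HWS (bigD1 M) //= eqxx.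
rewrite [X in _ + X](_ : _ = \sum_(M' : state V1 V2 | M' != M) hws_move lam w (val M) (val M')).
  by rewrite subrK.
by apply: eq_bigr => M' /negbTE ->.
Qed.

Lemma P_off (M M' : state V1 V2) : M' != M -> P M M' = hws_move lam w (val M) (val M').
Proof. by move=> /negbTE h; rewrite /P /P_HWS h. Qed.

Lemma P_lazy (M : state V1 V2) : 2^-1 <= P M M.
Proof.
rewrite /P /P_HWS eqxx.
have h : \sum_(M' : state V1 V2 | M' != M) hws_move lam w (val M) (val M') <= 2^-1.
  apply: le_trans (sum_move_le M); apply: ler_sum_sub => // M' _; exact: move_ge0.
lra.
Qed.

Lemma P_ge0 (M M' : state V1 V2) : 0 <= P M M'.
Proof.
case: (eqVneq M' M) => [->|/P_off ->]; last exact: move_ge0.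
by apply: le_trans (P_lazy M); rewrite invr_ge0.
Qed.

Lemma P_rev (M M' : state V1 V2) : p M * P M M' = p M' * P M' M.
Proof.
case: (eqVneq M' M) => [->//|ne].
have ne' : M != M' by rewrite eq_sym.
rewrite (P_off ne) (P_off ne').
by rewrite /p /pi_HWS mulrAC [RHS]mulrAC !hws_weightE set_weight_move_sym.
Qed.

(** * Comparison of the Dirichlet form with the edge and slide energies *)

Section DirichletForm.
Variable g : state V1 V2 -> R.

(** Allows evaluation at [full s] and [holed s u] without membership proofs; both are always states,
    so the value 0 is never taken there by default. *)
Definition extend_state M : R := if insub M is Some m then g m else 0.
Let gP s := extend_state (full s).
Let gN s u := extend_state (holed s u).

Lemma extend_stateE (M : state V1 V2) : extend_state (val M) = g M.
Proof. by rewrite /extend_state valK. Qed.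

Lemma dirichlet_moves : Zt * dirichlet p P g =
  \sum_(M : state V1 V2) set_weight (val M) * \sum_(M' : state V1 V2)
     hws_move lam w (val M) (val M') * (extend_state (val M) - extend_state (val M')) ^+ 2.
Proof.
rewrite /dirichlet mulr_sumr; apply: eq_bigr => M _.
rewrite !mulr_sumr; apply: eq_bigr => M' _; rewrite !extend_stateE.
case: (eqVneq M' M) => [->|ne]; first by rewrite subrr expr0n !mulr0.
rewrite P_off // /p /pi_HWS -/Zt hws_weightE !mulrA; congr (_ * _ * _).
by congr (_ * _); rewrite mulrAC mulfV ?mul1r // lt0r_neq0 // total_weight_gt0.
Qed.

Definition move_energy : R := \sum_u \sum_s near_weight A s u *
  (\sum_(x | x != u) (A u (s x) * L (s u) (s x) * (gN s u - gN (tperm u x * s)%g x) ^+ 2 +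
     A x (s u) * Rs u x * (gN s u - gN (tperm u x * s)%g u) ^+ 2)).

(** Deletions contribute n^2 / (2n) = n/2 and slides 1/2 after cancellation of the total weight;
    insertions are dropped as nonnegative. *)
Lemma dirichlet_lower :
  n / 2 * edge_energy A gP gN + move_energy / 2 <= Zt * dirichlet p P g.
Proof.
rewrite dirichlet_moves.
rewrite (sum_state betaK gammaK (fun X => set_weight X * \sum_(M' : state V1 V2)
     hws_move lam w X (val M') * (extend_state X - extend_state (val M')) ^+ 2)).
apply: lerD.
  rewrite /edge_energy mulr_sumr; apply: ler_sum => s _.
  rewrite (sum_move_full (fun X => (gP s - extend_state X) ^+ 2)) set_weight_full.
  rewrite le_eqVlt; apply/orP; left; apply/eqP.
  under [in RHS]eq_bigr do rewrite -sqrrN opprB.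
  by move: (\sum_x _) => E; field; rewrite lt0r_neq0.
rewrite /move_energy mulr_suml; apply: ler_sum => u _.
rewrite mulr_suml; apply: ler_sum => s _.
rewrite (sum_move_holed (fun X => (gN s u - extend_state X) ^+ 2)) set_weight_holed.
have W0 := Wt_gt0 u (s u); move: (Wt u (s u)) W0 => W W0.
set E := \sum_(x | _) _; set E' := (X in _ <= _ * (_ * (_ + X))).
have -> : W * near_weight A s u * ((2 * W)^-1 * (n * A u (s u) * (gN s u - extend_state (full s)) ^+ 2 + E'))
  = near_weight A s u * (n * A u (s u) * (gN s u - extend_state (full s)) ^+ 2 + E) / 2.
  by rewrite /E' /E; field; rewrite lt0r_neq0.
rewrite ler_pM2r ?invr_gt0 // ler_pM2l ?near_weight_gt0 // lerDr.
by rewrite mulr_ge0 ?sqr_ge0 // mulr_ge0 // ltW.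
Qed.

Lemma slide_energy_le : slide_energy A gN <= 2 / perfect_total A * move_energy.
Proof.
rewrite /slide_energy exchange_big /move_energy mulr_sumr; apply: ler_sum => u _.
rewrite mulr_sumr; apply: ler_sum => s _.
rewrite mulrCA ler_pM2l ?near_weight_gt0 // (reindex_inj (@perm_inj _ s)) -big_split /=.
(* The term at [u] is not a move and has difference zero, which leaves only the range where the
   lower bounds on the slide rates hold. *)
rewrite (bigD1 u) //= [X in X + _](_ : _ = 0) ?add0r; last first.
  by rewrite /diffL /diffR permK tperm1 mul1g subrr expr0n !mulr0 addr0.
rewrite mulr_sumr; apply: ler_sum => x xu; rewrite mulrDr.
have sxu : s x != s u by rewrite (inj_eq perm_inj).
rewrite /diffL /diffR permK; apply: lerD; rewrite [leRHS]mulrA; apply: (ler_wpM2r (sqr_ge0 _)).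
  rewrite [leRHS]mulrCA; apply: ler_wpM2l; first exact/ltW.
  exact: slideL_lower.
rewrite [leRHS]mulrCA; apply: ler_wpM2l; first exact/ltW.
exact: slideR_lower.
Qed.

End DirichletForm.

Let H : R := \sum_(d < #|V1|.-1) d.+2%:R^-1.
(** [8 * n ^+ 2] comes from [total_weight_upper], 48 is the 12 of [hole_poincare] times the 4 of
    [slide_energy_dirichlet], and 2 accounts for the edge energy. *)
Definition gap_bound : R := 8 * n ^+ 2 * (48 * H + 2).

Lemma H_ge0 : 0 <= H.
Proof. by apply: sumr_ge0 => d _; rewrite invr_ge0. Qed.

Lemma gap_bound_ge0 : 0 <= gap_bound.
Proof. by rewrite mulr_ge0 ?mulr_ge0 ?exprn_ge0 ?(ltW n_gt0) // addr_ge0 // mulr_ge0 // H_ge0. Qed.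

(** * The Poincare bound for the indicator of a class *)

Section Poincare.
Variable g : state V1 V2 -> R.
Let gx := extend_state g.
(** The total weight depends only on the holes, so the stationary law is proportional to activity on
    each class: [e0] is the conditional mean of [g] on perfect matchings, and [delta] the deviation
    of the conditional mean on a hole class from it. *)
Let e0 : R := (\sum_s perm_weight A s * gx (full s)) / perfect_total A.
Let delta u v : R :=
  (\sum_(s : {perm V1} | s u == v) near_weight A s u * (gx (holed s u) - e0)) / near_total A u v.

Lemma move_energy_ge0 : 0 <= move_energy g.
Proof.
apply: sumr_ge0 => u _; apply: sumr_ge0 => s _; rewrite mulr_ge0 ?(ltW (near_weight_gt0 A_gt0 s u)) //.
apply: sumr_ge0 => x _; apply: addr_ge0; rewrite mulr_ge0 ?sqr_ge0 //;
  by rewrite mulr_ge0 ?slideL_ge0 ?slideR_ge0 // ltW.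
Qed.

Lemma edge_energy_le : edge_energy A (fun s => gx (full s)) (fun s u => gx (holed s u))
  <= Zt * dirichlet p P g.
Proof.
have h := dirichlet_lower g; have m0 := move_energy_ge0.
apply: le_trans h; set E := edge_energy _ _ _.
have E0 : 0 <= E.
  apply: sumr_ge0 => s _; rewrite mulr_ge0 ?(ltW (perm_weight_gt0 A_gt0 s)) // sumr_ge0 // => x _.
  exact: sqr_ge0.
(* At least two vertices per side make the coefficient [n / 2] of the edge energy at least 1. *)
have n2 : 2 <= n by rewrite /n ler_nat.
have := ler_wpM2r E0 n2; lra.
Qed.

Lemma slide_energy_dirichlet : slide_energy A (fun s u => gx (holed s u))
  <= 4 / perfect_total A * (Zt * dirichlet p P g).
Proof.
apply: le_trans (slide_energy_le g) _.
have z0 := perfect_total_gt0 A_gt0.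
have h := dirichlet_lower g.
have E0 : 0 <= edge_energy A (fun s => gx (full s)) (fun s u => gx (holed s u)).
  apply: sumr_ge0 => s _; rewrite mulr_ge0 ?(ltW (perm_weight_gt0 A_gt0 s)) // sumr_ge0 // => x _.
  exact: sqr_ge0.
have nE := mulr_ge0 (ltW n_gt0) E0.
rewrite -!mulrA !(mulrCA _ (perfect_total A)^-1) ler_pM2l ?invr_gt0 //; rewrite -/gx in h; lra.
Qed.

Lemma delta_bound u v : delta u v ^+ 2 <= gap_bound * dirichlet p P g.
Proof.
have z0 := perfect_total_gt0 A_gt0; have n1 := near_total_gt0 A_gt0 u v; have h0 := H_ge0.
pose gP s := gx (full s); pose gN s u := gx (holed s u).
have := hole_poincare A_gt0 gP gN u v; rewrite -/H pair_mean => h.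
have dE : delta u v = ((\sum_(s : {perm V1} | s u == v) near_weight A s u * gx (holed s u)) * perfect_total A -
   near_total A u v * (\sum_s perm_weight A s * gx (full s))) / (near_total A u v * perfect_total A).
  rewrite /delta; under eq_bigr do rewrite mulrBr.
  rewrite sumrB -mulr_suml -/(near_total A u v) /e0.
  by field; rewrite !lt0r_neq0.
rewrite dE expr_div_n ler_pdivrMr ?exprn_gt0 ?mulr_gt0 //; apply: le_trans h _.
rewrite exprMn [leRHS]mulrCA ler_pM2l ?exprn_gt0 //.
have D0 : 0 <= dirichlet p P g.
  apply: sumr_ge0 => M _; apply: sumr_ge0 => M' _.
  by rewrite mulr_ge0 ?sqr_ge0 // mulr_ge0 ?pi_ge0 ?P_ge0.
set D := dirichlet p P g in D0 *.
have e1 : Zt * D <= 8 * n ^+ 2 * perfect_total A * D by rewrite ler_wpM2r // total_weight_upper.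
have e2 : 12 * H * perfect_total A ^+ 2 * slide_energy A (fun s u => gx (holed s u)) <=
    48 * H * perfect_total A * (Zt * D).
  have -> : 48 * H * perfect_total A * (Zt * D) = 12 * H * perfect_total A ^+ 2 * (4 / perfect_total A * (Zt * D)).
    by field; rewrite lt0r_neq0.
  by rewrite ler_wpM2l ?slide_energy_dirichlet // mulr_ge0 ?sqr_ge0 // mulr_ge0.
have e3 : 2 * perfect_total A * edge_energy A (fun s => gx (full s)) (fun s u => gx (holed s u)) <=
    2 * perfect_total A * (Zt * D).
  by rewrite ler_wpM2l ?edge_energy_le // mulr_ge0 // ltW.
have e4 : (48 * H + 2) * perfect_total A * (Zt * D) <= (48 * H + 2) * perfect_total A * (8 * n ^+ 2 * perfect_total A * D).
  by rewrite ler_wpM2l // mulr_ge0 ?(ltW z0) // addr_ge0 // mulr_ge0.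
have -> : gap_bound * D * perfect_total A ^+ 2 = (48 * H + 2) * perfect_total A * (8 * n ^+ 2 * perfect_total A * D).
  by rewrite /gap_bound; ring.
lra.
Qed.

Lemma pi_mean (F : {set V1 * V2} -> R) :
  Zt * \sum_(M : state V1 V2) p M * F (val M) =
  n ^+ 2 * (\sum_s perm_weight A s * F (full s)) +
  \sum_u \sum_v Wt u v * (\sum_(s : {perm V1} | s u == v) near_weight A s u * F (holed s u)).
Proof.
rewrite -sum_set_weight mulr_sumr; apply: eq_bigr => M _.
rewrite /p /pi_HWS -/Zt hws_weightE mulrA; congr (_ * _).
by rewrite mulrC mulfVK // lt0r_neq0 // total_weight_gt0.
Qed.

Lemma full_mean0 : \sum_s perm_weight A s * (gx (full s) - e0) = 0.
Proof.
under eq_bigr do rewrite mulrBr.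
rewrite sumrB -mulr_suml -/(perfect_total A) /e0 mulrC divfK ?subrr //.
by rewrite lt0r_neq0 // perfect_total_gt0.
Qed.

Lemma hole_meanE u v : \sum_(s : {perm V1} | s u == v) near_weight A s u * (gx (holed s u) - e0) =
  near_total A u v * delta u v.
Proof. by rewrite mulrC divfK // lt0r_neq0 // near_total_gt0. Qed.

(** Perfect matchings contribute nothing, as [e0] is their mean. Each hole class contributes its
    mass times [delta], and Jensen's inequality applies since these masses sum to at most 1. *)
Lemma deviation_mean :
  (\sum_(M : state V1 V2) p M * (g M - e0)) ^+ 2 <= gap_bound * dirichlet p P g.
Proof.
have Z0' := total_weight_gt0.
have e : Zt * \sum_(M : state V1 V2) p M * (g M - e0) =
   \sum_(q : V1 * V1) Wt q.1 q.2 * near_total A q.1 q.2 * delta q.1 q.2.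
  have <- : \sum_(M : state V1 V2) p M * (gx (val M) - e0) =
     \sum_(M : state V1 V2) p M * (g M - e0).
    by apply: eq_bigr => M _; rewrite /gx extend_stateE.
  rewrite (pi_mean (fun X => gx X - e0)) full_mean0 mulr0 add0r pair_bigA /=.
  by apply: eq_bigr => -[u v] _ /=; rewrite hole_meanE mulrA.
have q0 (q : V1 * V1) : true -> 0 <= Wt q.1 q.2 * near_total A q.1 q.2.
  by rewrite mulr_ge0 // ltW ?Wt_gt0 ?near_total_gt0.
rewrite -(ler_pM2l (exprn_gt0 2 Z0')) -exprMn e.
apply: le_trans (wsum_sqr_le _ q0) _.
set Q := \sum_q _.
have QZ : Q <= Zt.
  rewrite total_weight_sum pair_bigA /= lerDr.
  by rewrite mulr_ge0 ?exprn_ge0 ?(ltW n_gt0) // ltW // perfect_total_gt0.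
have Q0 : 0 <= Q by exact: sumr_ge0.
have B0 : 0 <= gap_bound * dirichlet p P g.
  (* An arbitrary vertex is used for both holes, only to see that the bound is nonnegative. *)
  exact: le_trans (sqr_ge0 _) (delta_bound (enum_val (Ordinal (ltnW n_gt1))) (enum_val (Ordinal (ltnW n_gt1)))).
apply: (@le_trans _ _ (Q * (Q * (gap_bound * dirichlet p P g)))).
  apply: ler_wpM2l => //; rewrite [leRHS]mulr_suml; apply: ler_sum => q _.
  by apply: ler_wpM2l; [exact: q0 | exact: delta_bound].
rewrite mulrA ler_wpM2r // expr2 ler_pM //.
Qed.

Variable S : {set {set V1 * V2}}.
Hypothesis SP : S = perfect_matchings V1 V2 \/ exists u (v : V2), S = near_matchings u v.
Let ind X : R := (X \in S)%:R.
Let pS : R := \sum_(M : state V1 V2) p M * ind (val M).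

(** The mean in question is 0 when [S] is the class of perfect matchings and [pS] times [delta] when
    it is a hole class; this is the source of the factor [pS ^+ 2]. *)
Lemma deviation_class :
  (\sum_(M : state V1 V2) p M * (ind (val M) * (g M - e0))) ^+ 2 <=
  pS ^+ 2 * (gap_bound * dirichlet p P g).
Proof.
have Z0' := total_weight_gt0.
rewrite -(ler_pM2l (exprn_gt0 2 Z0')) -exprMn [leRHS]mulrA -exprMn.
have -> : \sum_(M : state V1 V2) p M * (ind (val M) * (g M - e0)) =
    \sum_(M : state V1 V2) p M * (ind (val M) * (gx (val M) - e0)).
  by apply: eq_bigr => M _; rewrite /gx extend_stateE.
rewrite (pi_mean (fun X => ind X * (gx X - e0))) (pi_mean ind).
case: SP => [SE|[u0 [v0 SE]]].
  have -> : \sum_s perm_weight A s * (ind (full s) * (gx (full s) - e0)) = 0.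
    rewrite -[RHS]full_mean0; apply: eq_bigr => s _.
    by rewrite /ind SE (full_perfect betaK gammaK) mul1r.
  rewrite mulr0 add0r big1 ?expr0n /= => [|u _]; last first.
    rewrite big1 // => v _; rewrite big1 ?mulr0 // => s _.
    by rewrite /ind SE (negbTE (holed_not_perfect betaK gammaK s u)) mul0r mulr0.
  rewrite mulr_ge0 ?sqr_ge0 //.
  exact: le_trans (sqr_ge0 _) (delta_bound (enum_val (Ordinal (ltnW n_gt1))) (enum_val (Ordinal (ltnW n_gt1)))).
have full0 (F : {perm V1} -> R) : \sum_s perm_weight A s * (ind (full s) * F s) = 0.
  by apply: big1 => s _; rewrite /ind SE (negbTE (full_not_near betaK gammaK s u0 v0)) mul0r mulr0.
have holes (F : {perm V1} -> V1 -> R) :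
   \sum_u \sum_v Wt u v * (\sum_(s : {perm V1} | s u == v) near_weight A s u * (ind (holed s u) * F s u)) =
   Wt u0 (gamma v0) * (\sum_(s : {perm V1} | s u0 == gamma v0) near_weight A s u0 * F s u0).
  rewrite (bigD1 u0) //= [X in _ + X]big1 ?addr0 => [|u uu0]; last first.
    rewrite big1 // => v _; rewrite big1 ?mulr0 // => s _.
    by rewrite /ind SE (near_holed betaK gammaK) eq_sym (negbTE uu0) mul0r mulr0.
  rewrite (bigD1 (gamma v0)) //= [X in _ + X]big1 ?addr0 => [|v vv0]; last first.
    rewrite big1 ?mulr0 // => s /eqP sv.
    rewrite /ind SE (near_holed betaK gammaK) eqxx sv /= (_ : (v0 == beta v) = false) ?mul0r ?mulr0 //.
    by apply: contra_neqF vv0 => /eqP ->; rewrite betaK.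
  congr (_ * _); apply: eq_bigr => s /eqP sv.
  by rewrite /ind SE (near_holed betaK gammaK) sv gammaK !eqxx mul1r.
under [X in _ <= (_ * X + _) ^+ 2 * _]eq_bigr do rewrite -[ind _]mulr1.
under [X in _ <= (_ + X) ^+ 2 * _]eq_bigr => u _.
  under eq_bigr => v _.
    under eq_bigr do rewrite -[ind _]mulr1.
    over.
  over.
rewrite (full0 (fun s => gx (full s) - e0)) (full0 (fun=> 1)) !mulr0 !add0r.
rewrite (holes (fun s u => gx (holed s u) - e0)) (holes (fun _ _ => 1)) hole_meanE.
under [X in _ <= (_ * X) ^+ 2 * _]eq_bigr do rewrite mulr1.
rewrite -/(near_total A u0 (gamma v0)) mulrA exprMn ler_wpM2l ?sqr_ge0 //.
exact: delta_bound.
Qed.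

(** Subtracting [e0] from [g] does not change the covariance, which becomes [X - pS * Y]; its square
    is at most twice the sum of the two squares, each bounded above, whence the 4. *)
Lemma class_poincare :
  mean_prod p (fun M : state V1 V2 => ind (val M) - pS) g ^+ 2 <= 4 * pS ^+ 2 * gap_bound * dirichlet p P g.
Proof.
set X := \sum_(M : state V1 V2) p M * (ind (val M) * (g M - e0)).
set Y := \sum_(M : state V1 V2) p M * (g M - e0).
have -> : mean_prod p (fun M : state V1 V2 => ind (val M) - pS) g = X - pS * Y.
  have : \sum_(M : state V1 V2) p M * (ind (val M) - pS) = 0.
    under eq_bigr do rewrite mulrBr.
    by rewrite sumrB -mulr_suml pi_sum1 mul1r subrr.
  move=> z; transitivity (mean_prod p (fun M : state V1 V2 => ind (val M) - pS) g
     - e0 * \sum_(M : state V1 V2) p M * (ind (val M) - pS)); first by rewrite z mulr0 subr0.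
  rewrite /mean_prod /X /Y !mulr_sumr -!sumrB; apply: eq_bigr => M _; ring.
have h1 := deviation_class; have h2 := ler_wpM2l (sqr_ge0 pS) deviation_mean.
rewrite -/X in h1; rewrite -/Y in h2.
have := sqr_ge0 (X + pS * Y).
move: X Y (dirichlet p P g) h1 h2 => X Y D.
rewrite !expr2; lra.
Qed.
End Poincare.

Lemma pi_HWS_setE (S : {set {set V1 * V2}}) :
  \sum_(M : state V1 V2) p M * (val M \in S)%:R = pi_HWS_set lam w S.
Proof.
rewrite /pi_HWS_set [RHS]big_mkcond; apply: eq_bigr => M _.
by case: ifP => _; rewrite ?mulr1 ?mulr0.
Qed.

Lemma variance_bound (S : {set {set V1 * V2}}) :
  S = perfect_matchings V1 V2 \/ (exists u (v : V2), S = near_matchings u v) ->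
  forall (d : measure_display) (Om : measurableType d) (Pr : probability Om R)
    (X : nat -> Om -> state V1 V2), markov_chain p P Pr X ->
  forall T, (0 < T)%N ->
  ('V_Pr[fun om => (T%:R^-1 * \sum_(0 <= t < T) (val (X t om) \in S)%:R)%R] <=
    (16 * pi_HWS_set lam w S ^+ 2 * gap_bound / T%:R)%:E)%E.
Proof.
move=> SP d Om Pr X chain T T0.
rewrite (variance_time_average P_sum1 P_rev chain (fun M : state V1 V2 => (val M \in S)%:R) T0) lee_fin.
rewrite pi_HWS_setE.
set pS := pi_HWS_set lam w S.
have K0 : 0 <= 4 * pS ^+ 2 * gap_bound by rewrite mulr_ge0 ?gap_bound_ge0 // mulr_ge0 ?sqr_ge0.
have hS g := class_poincare g SP; rewrite pi_HWS_setE -/pS in hS.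
(* 16 is the 4 of [class_poincare] times the 4 of the correlation sum, and its factor [T] cancels
   one of the two from averaging. *)
have := sum_sum_corr_le pi_ge0 P_ge0 P_sum1 P_rev P_lazy K0 hS T.
have T0' : (0 : R) < T%:R by rewrite ltr0n.
move=> /(ler_wpM2l (sqr_ge0 T%:R^-1)) /le_trans; apply.
rewrite le_eqVlt; apply/orP; left; apply/eqP.
by field; rewrite lt0r_neq0.
Qed.

End HWSChain.

(** * The harmonic sum and the final constant *)

Lemma harmonic_le_ln (R : realType) m : \sum_(d < m) d.+2%:R^-1 <= ln m.+1%:R :> R.
Proof.
elim: m => [|m IH]; first by rewrite big_ord0 ln1.
rewrite big_ord_recr /=; apply: le_trans (lerD IH (lexx _)) _.
set y : R := m.+2%:R^-1.
have n2 : (0 : R) < m.+2%:R by [].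
(* From 1 - y <= exp(-y) at y = 1/(m+2): the logarithm grows by at least y from m+1 to m+2. *)
have h : m.+1%:R <= m.+2%:R * expR (- y).
  have := expR_ge1Dx (- y); rewrite -(ler_pM2l n2) mulrDr mulrN mulr1 mulfV ?lt0r_neq0 //.
  by rewrite -[m.+2%:R]natr1 addrK.
have : ln m.+1%:R <= ln (m.+2%:R * expR (- y)).
  by rewrite ler_ln ?posrE ?mulr_gt0 ?expR_gt0 ?ltr0n.
rewrite lnM ?posrE ?expR_gt0 // expRK; lra.
Qed.

Theorem lemma9 (R : realType) :
  exists C : R, 0 < C /\
    forall (n : nat) (V1 V2 : finType),
      (2 <= n)%N -> #|V1| = n -> #|V2| = n ->
    forall lam w : V1 * V2 -> R,
      (forall e, 0 < lam e) -> rough lam w ->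
    forall (d : measure_display) (Om : measurableType d)
           (Pr : probability Om R) (X : nat -> Om -> state V1 V2),
      markov_chain (pi_HWS lam w) (P_HWS lam w) Pr X ->
    forall S : {set {set V1 * V2}},
      (S = perfect_matchings V1 V2 \/ exists u v, S = near_matchings u v) ->
    forall T : nat, (1 <= T)%N ->
      ('V_Pr[fun om => (T%:R^-1 * \sum_(0 <= t < T) (val (X t om) \in S)%:R)%R]
        <= (C * n%:R ^+ 2 * ln n%:R / T%:R * pi_HWS_set lam w S ^+ 2)%:E)%E.
Proof.
have l2 : 0 < ln 2 :> R by rewrite ln_gt0 // ltr1n.
(* 128 = 16 * 8, from [variance_bound] and [gap_bound]; the term 2 / ln 2 absorbs the additive 2 of
   [gap_bound], as ln n >= ln 2. *)
exists (128 * (48 + 2 / ln 2)); split.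
  by rewrite mulr_gt0 // addr_gt0 // divr_gt0.
move=> n V1 V2 n2 c1 c2 lam w lam0 rw d Om Pr X chain S SP T T0.
have c12 : #|V1| = #|V2| by rewrite c1 c2.
pose beta (x : V1) : V2 := enum_val (cast_ord c12 (enum_rank x)).
pose gamma (y : V2) : V1 := enum_val (cast_ord (esym c12) (enum_rank y)).
have betaK : cancel beta gamma.
  by move=> x; rewrite /gamma /beta enum_valK cast_ordK enum_rankK.
have gammaK : cancel gamma beta.
  by move=> y; rewrite /gamma /beta enum_valK cast_ordKV enum_rankK.
have n2' : (1 < #|V1|)%N by rewrite c1.
apply: le_trans (variance_bound betaK gammaK lam0 rw n2' SP chain T0) _.
rewrite lee_fin /gap_bound c1.
set H := \sum_(d < _) _.
have HL : H <= ln n%:R.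
  by have := harmonic_le_ln R n.-1; rewrite prednK // (ltn_trans _ n2).
have L2 : ln 2 <= ln n%:R :> R by rewrite ler_ln ?posrE ?ltr0n ?ler_nat // (ltn_trans _ n2).
have h : 48 * H + 2 <= (48 + 2 / ln 2) * ln n%:R.
  have : (2 : R) <= 2 / ln 2 * ln n%:R by rewrite mulrAC ler_pdivlMr // ler_pM2l.
  lra.
have T1 : (0 : R) < T%:R by rewrite ltr0n.
have q0 : 0 <= 128 * n%:R ^+ 2 / T%:R * pi_HWS_set lam w S ^+ 2.
  by rewrite mulr_ge0 ?sqr_ge0 // divr_ge0 ?(ltW T1) // mulr_ge0 ?sqr_ge0.
have := ler_wpM2l q0 h; move: (48 + 2 / ln 2) => c; lra.
Qed.
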